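(* Let $\Phi$ be a $C^5$ convex function on an open convex set $\Omega\subset\mathbb{R}^n$ satisfying $e^{-V}=e^{-W(\nabla\Phi)}\det D^2\Phi$ with $V,W$ of class $C^3$. Let $g_{ij}=\Phi_{iab}\Phi_j^{ab}$. Then the weighted Laplacian of the $(0,2)$-tensor $g$ is $$\begin{aligned} L g_{ij}={}&(-V_{iab}+W_{iab})\Phi^{ab}_j+(-V_{jab}+W_{jab})\Phi^{ab}_i\\ &+\tfrac12\bigl((V_{is}+W_{is})g^s_j+(V_{js}+W_{js})g^s_i\bigr)+2(V_{am}+W_{am})\Phi^m_{ib}\Phi^{ab}_j\\ &+\tfrac12 g_{ki}g^k_j+2\nabla_p\Phi_{iab}\nabla^p\Phi_j^{ab}+8\,\mathrm{R}_{iabc}\mathrm{R}_j^{abc}. \end{aligned}$$ In particular, if $\Phi$ satisfies $e^{-\alpha\Phi}=\det D^2\Phi$ for some $\alpha\in\mathbb{R}$ (so $V=\alpha\Phi$, $W=0$), then $$L g_{ij}=g_{ki}(\mathrm{Ric}_\mu)^k_j+g_{kj}(\mathrm{Ric}_\mu)^k_i+2\nabla_p\Phi_{iab}\nabla^p\Phi_j^{ab}+8\,\mathrm{R}_{iabc}\mathrm{R}_j^{abc},$$ which implies $$L g\ge 2\,g\odot\mathrm{Ric}_\mu .$$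
   Context: Setting. $\Omega$ is equipped with the Hessian Riemannian metric $h=\Phi_{ij}dx^idx^j$ and the measure $\mu=e^{-V}dx$. Notation, in the fixed Euclidean coordinates: $\Phi_{ij}=\partial^2_{x_ix_j}\Phi$, $\Phi_{ijk}=\partial^3_{x_ix_jx_k}\Phi$; $V_i,V_{ij},V_{ijk}$ are the Euclidean partial derivatives of $V$; $W^i=(\partial_{x_i}W)\circ\nabla\Phi$, $W^{ij}=(\partial^2_{x_ix_j}W)\circ\nabla\Phi$, $W^{ijk}=(\partial^3_{x_ix_jx_k}W)\circ\nabla\Phi$. Indices are raised and lowered with $h$: $\Phi^{ij}$ is the inverse matrix of $\Phi_{ij}$, so e.g. $W_i=\Phi_{ia}W^a$, $W_{ij}=\Phi_{ia}\Phi_{jb}W^{ab}$, $W_{ijk}=\Phi_{ia}\Phi_{jb}\Phi_{kc}W^{abc}$, $V^i=\Phi^{ij}V_j$, $\Phi_j^{ab}=\Phi^{ac}\Phi^{bd}\Phi_{jcd}$. Repeated indices are summed. $\nabla$ denotes the Levi-Civita covariant derivative of $h$ (with Christoffel symbols $\Gamma^k_{ij}=\frac12\Phi^k_{ij}$); $\Phi_{iab}$ is regarded as a $(0,3)$-tensor. The weighted Laplacian of a tensor $T$ is $LT=\Phi^{pq}\nabla_p\nabla_qT-\frac12(V^k+W^k)\nabla_kT$, and $Lg_{ij}$ means $(Lg)_{ij}$. The Riemann tensor of $h$ is $\mathrm{R}_{ikjl}=\frac14(\Phi_{ila}\Phi^a_{kj}-\Phi_{ija}\Phi^a_{kl})$.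 The Bakry-Émery tensor is $\mathrm{Ric}_\mu=\mathrm{Ric}+\nabla^2P$, where $\mathrm{Ric}$ is the Ricci tensor of $h$, $\nabla^2$ is the Hessian with respect to $h$, and $P=\frac12(V+W(\nabla\Phi))$; in coordinates $(\mathrm{Ric}_\mu)_{ij}=\frac14g_{ij}+\frac12V_{ij}+\frac12W_{ij}$. The symmetric product of $(0,2)$-tensors is $(T\odot S)_{ij}=\frac12(T_{ik}S^k_j+T_{jk}S^k_i)$. An inequality between symmetric $(0,2)$-tensors is in the sense of quadratic forms. *)

(* Defs.v *)
From HB Require Import structures.
From mathcomp Require Import all_boot all_order all_algebra.
From mathcomp Require Import all_classical all_reals all_analysis.

Set Implicit Arguments.
Unset Strict Implicit.
Unset Printing Implicit Defensive.

Import Order.TTheory GRing.Theory Num.Theory.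
Import numFieldNormedType.Exports.

Local Open Scope classical_set_scope.
Local Open Scope ring_scope.

Section Euclidean_calculus.
Variables (R : realType) (n : nat).
Local Notation point := 'rV[R]_n.

Definition partial (i : 'I_n) (f : point -> R) : point -> R :=
  fun x => 'D_(delta_mx 0 i) f x.

Definition D2 (f : point -> R) (i j : 'I_n) : point -> R :=
  partial i (partial j f).

Definition D3 (f : point -> R) (i j k : 'I_n) : point -> R :=
  partial i (D2 f j k).

Definition grad (f : point -> R) (x : point) : point :=
  \row_i partial i f x.

Definition hess (f : point -> R) (x : point) : 'M[R]_n :=
  \matrix_(i, j) D2 f i j x.

(* Intended for an open set A. *)
Fixpoint Ck_on (k : nat) (A : set point) (f : point -> R) : Prop :=
  {in A, continuous f} /\
  if k is k'.+1 then
    forall i, {in A, forall x, derivable f x (delta_mx 0 i)} /\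
              Ck_on k' A (partial i f)
  else True.

End Euclidean_calculus.

(* Tensor fields on an open subset of R^n are given by their components in    *)
(* the Euclidean coordinates: T i j : 'rV_n -> R is the function T_ij.        *)
Section Riemannian_metric.
Variables (R : realType) (n : nat).
Local Notation point := 'rV[R]_n.
Local Notation field := (point -> R).
Local Notation tensor1 := ('I_n -> field).
Local Notation tensor2 := ('I_n -> tensor1).
Local Notation tensor3 := ('I_n -> tensor2).
Local Notation tensor4 := ('I_n -> tensor3).
Variable h : point -> 'M[R]_n.
Implicit Types (i j k l p : 'I_n) (x : point).

Definition hinv i j : field := fun x => invmx (h x) i j.

Definition raise (w : tensor1) : tensor1 := fun i x =>
  \sum_a hinv i a x * w a x.

Definition raise2 (T : tensor2) : tensor2 := fun i j =>
  raise (fun a => raise (T a) j) i.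

Definition raise3 (T : tensor3) : tensor3 := fun i j k =>
  raise (fun a => raise2 (T a) j k) i.

Definition lower (w : tensor1) : tensor1 := fun i x =>
  \sum_a h x i a * w a x.

Definition lower2 (T : tensor2) : tensor2 := fun i j =>
  lower (fun a => lower (T a) j) i.

Definition lower3 (T : tensor3) : tensor3 := fun i j k =>
  lower (fun a => lower2 (T a) j k) i.

(* mixed T k j = T^k_j *)
Definition mixed (T : tensor2) : tensor2 := fun k j =>
  raise (fun a => T a j) k.

(* christoffel k i j = Gamma^k_ij of the Levi-Civita connection of h *)
Definition christoffel k i j : field :=
  raise (fun l x => 2^-1 * (partial i (fun y => h y j l) x
                          + partial j (fun y => h y i l) x
                          - partial l (fun y => h y i j) x)) k.

(* Covariant derivatives of covariant tensors; the index of differentiation   *)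
(* comes first: cov2 T p i j = nabla_p T_ij.                                  *)
Definition cov1 (w : tensor1) : tensor2 := fun p i x =>
  partial p (w i) x - \sum_a christoffel a p i x * w a x.

Definition cov2 (T : tensor2) : tensor3 := fun p i j x =>
  partial p (T i j) x - \sum_a christoffel a p i x * T a j x
                      - \sum_a christoffel a p j x * T i a x.

Definition cov3 (T : tensor3) : tensor4 := fun p i j k x =>
  partial p (T i j k) x - \sum_a christoffel a p i x * T a j k x
                        - \sum_a christoffel a p j x * T i a k x
                        - \sum_a christoffel a p k x * T i j a x.

Definition covHess (f : field) : tensor2 := cov1 (fun i => partial i f).

(* riemann i k j l = h(Rm(d_i, d_k) d_l, d_j), where                          *)
(* Rm(X, Y) = [nabla_X, nabla_Y] - nabla_[X, Y]: the sign and the order of    *)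
(* the indices are those for which Ric_ij = h^kl R_ikjl, and for a Hessian    *)
(* metric h = D^2 Phi, R_ikjl = (Phi_ila Phi^a_kj - Phi_ija Phi^a_kl) / 4.    *)
Definition riemann : tensor4 := fun i k j l =>
  lower (fun m x =>
    partial i (christoffel m k l) x - partial k (christoffel m i l) x
    + \sum_a (christoffel m i a x * christoffel a k l x
            - christoffel m k a x * christoffel a i l x)) j.

Definition ricci : tensor2 := fun i j x =>
  \sum_k \sum_l hinv k l x * riemann i k j l x.

Definition sym_prod (T S : tensor2) : tensor2 := fun i j x =>
  2^-1 * \sum_k (T i k x * mixed S k j x + T j k x * mixed S k i x).

End Riemannian_metric.

Definition quad_le (R : realType) (n : nat) (S T : 'I_n -> 'I_n -> R) : Prop :=
  forall v : 'I_n -> R,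
    \sum_i \sum_j S i j * v i * v j <= \sum_i \sum_j T i j * v i * v j.

Section Hessian_metric.
Variables (R : realType) (n : nat).
Local Notation point := 'rV[R]_n.
Local Notation field := (point -> R).
Local Notation tensor1 := ('I_n -> field).
Local Notation tensor2 := ('I_n -> tensor1).
Local Notation tensor3 := ('I_n -> tensor2).
Variables Phi V W : field.
Local Notation h := (hess Phi).

(* Phi3_uu j a b = Phi_j^ab *)
Definition Phi3_uu : tensor3 := fun j => raise2 h (D3 Phi j).

(* Phi3_u m i b = Phi^m_ib *)
Definition Phi3_u : tensor3 := fun m i b => raise h (fun k => D3 Phi k i b) m.

(* W1u i = W^i, W2l i j = W_ij, W3l i j k = W_ijk, V1u i = V^i *)
Definition W1u : tensor1 := fun i x => partial i W (grad Phi x).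
Definition W2l : tensor2 := lower2 h (fun i j x => D2 W i j (grad Phi x)).
Definition W3l : tensor3 := lower3 h (fun i j k x => D3 W i j k (grad Phi x)).

Definition V1u : tensor1 := raise h (fun i => partial i V).

Definition gtensor : tensor2 := fun i j x =>
  \sum_a \sum_b D3 Phi i a b x * Phi3_uu j a b x.

Definition wlaplacian (T : tensor2) : tensor2 := fun i j x =>
  \sum_p \sum_q hinv h p q x * cov3 h (cov2 h T) p q i j x
  - 2^-1 * \sum_k (V1u k x + W1u k x) * cov2 h T k i j x.

Definition ric_mu : tensor2 := fun i j x =>
  ricci h i j x + covHess h (fun y => 2^-1 * (V y + W (grad Phi y))) i j x.

(* nabla_p Phi_iab nabla^p Phi_j^ab *)
Definition nabla_sq : tensor2 := fun i j x =>
  \sum_p \sum_a \sum_b cov3 h (D3 Phi) p i a b x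
    * raise3 h (fun q c d => cov3 h (D3 Phi) q j c d) p a b x.

(* R_iabc R_j^abc *)
Definition riem_sq : tensor2 := fun i j x =>
  \sum_a \sum_b \sum_c riemann h i a b c x * raise3 h (riemann h j) a b c x.

End Hessian_metric.

(* Main.v *)
Require Import Defs.
From HB Require Import structures.
From mathcomp Require Import all_boot all_order all_algebra.
From mathcomp Require Import all_classical all_reals all_analysis.
From mathcomp Require Import ring lra.

Set Implicit Arguments.
Unset Strict Implicit.
Unset Printing Implicit Defensive.

Import Order.TTheory GRing.Theory Num.Theory.
Import numFieldNormedType.Exports.

Local Open Scope classical_set_scope.
Local Open Scope ring_scope.

(** Every component that enters the two identities is a sum of contracted
    products of finitely many symmetric tensors at one point: the inverse metric
    Phi^ab, the partial derivatives of Phi of order three to five, and the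
    derivatives W_i, W_ij, W_ijk with lowered indices.  For the covariant
    derivatives and the curvature this is so because these tensors are closed
    under differentiation,
      d_p Phi^ab = - Phi^ac Phi^bd Phi_pcd,   d_p W_i = W_pi + Phi_pia Phi^ab W_b,
    and so on.  For the derivatives of V it comes from the equation: by Jacobi's
    formula its logarithmic derivative is V_i = W_i - Phi^ab Phi_iab
    ([partial_V]), and this expresses V_ij and V_ijk by the same tensors.  The
    Laplacian of g contains the fifth derivatives of Phi only in the traced form
    Phi^pq Phi_pqiab, and this is what the third derivative of the equation,
    hence V_iab, provides.

    After this elimination both sides of the first identity are polynomials in
    symmetric tensors that satisfy no further relation, and they agree term by
    term, up to the names of the summed indices and the order of the indices of
    each factor.  The tensors are written as formal expressions, whose symbolic
    derivative computes partial derivatives ([is_derive_ev]); a decision procedure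
    expands the difference of two expressions and cancels the monomials that agree
    up to renaming, and its success implies equality of the values
    ([tensor_identityP]).  The same procedure gives the formula for the Riemann
    tensor of a Hessian metric and Ric_mu = g/4 + (V_ij + W_ij)/2.

    If V = alpha Phi and W = 0, then V_ij = alpha Phi_ij and
    V_ijk = alpha Phi_ijk, so that the terms with derivatives of V are multiples
    of g and the first identity collapses to the second one.  The last two terms
    of the latter are Gram matrices, for the product that h induces on tensors of
    type (0,3).  This product is positive: the Hessian of a convex function is
    positive semidefinite ([convex_hess_ge0]), hence its inverse has the form
    A^T A ([psd_factor]) and a squared norm is a sum of squares ([gram_ge0]).

    Derivatives are only assumed to exist along the coordinate axes, and the
    analysis rests on the mean value theorem along lines.  It yields the
    differentiability of functions of class C^1 and with it the chain rule, the
    symmetry of iterated partial derivatives, and the positivity of the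
    Hessian. *)

(** * Directional derivatives and functions of class C^1 *)

Section Derivation_rules.
Variables (R : realType) (V : normedModType R).
Implicit Types (f g : V -> R) (x v : V) (df dg : R).

Lemma is_derive_add x v f g df dg : is_derive x v f df -> is_derive x v g dg ->
  is_derive x v (fun y => f y + g y) (df + dg).
Proof. exact: is_deriveD. Qed.

Lemma is_derive_sub x v f g df dg : is_derive x v f df -> is_derive x v g dg ->
  is_derive x v (fun y => f y - g y) (df - dg).
Proof. exact: is_deriveB. Qed.

Lemma is_derive_opp x v f df : is_derive x v f df -> is_derive x v (fun y => - f y) (- df).
Proof. exact: is_deriveN. Qed.

Lemma is_derive_mul x v f g df dg : is_derive x v f df -> is_derive x v g dg ->
  is_derive x v (fun y => f y * g y) (df * g x + f x * dg).
Proof.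
move=> fd gd; apply: is_derive_eq (is_deriveM fd gd) _.
by rewrite addrC [g x *: _]mulrC.
Qed.

Lemma is_derive_const x v (c : R) : is_derive x v (fun=> c) 0.
Proof. exact: is_derive_cst. Qed.

Lemma is_derive_scale x v f df (c : R) :
  is_derive x v f df -> is_derive x v (fun y => c * f y) (c * df).
Proof.
move=> fd; apply: is_derive_eq (is_derive_mul (is_derive_const x v c) fd) _.
by rewrite mul0r add0r.
Qed.

Lemma is_derive_bigsum (I : Type) (r : seq I) (F : I -> V -> R) (dF : I -> R) x v :
  (forall i, is_derive x v (F i) (dF i)) ->
  is_derive x v (fun y => \sum_(i <- r) F i y) (\sum_(i <- r) dF i).
Proof.
move=> Fd; elim: r => [|i r IH].
  rewrite big_nil (_ : (fun y => _) = fun=> 0); first exact: is_derive_const.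
  by apply/funext => y; rewrite big_nil.
rewrite big_cons (_ : (fun y => _) = fun y => F i y + \sum_(j <- r) F j y).
  exact: is_derive_add.
by apply/funext => y; rewrite big_cons.
Qed.

Lemma is_derive_ext_near (P : set V) f g df x v : open P -> P x ->
  (forall y, P y -> f y = g y) -> is_derive x v g df -> is_derive x v f df.
Proof.
move=> Po Px fg; apply: near_eq_is_derive.
have : nbhs x P by exact: open_nbhs_nbhs.
by apply: filterS => y /fg.
Qed.

End Derivation_rules.
Section Lines.
Variables (R : realType) (V : normedModType R).
Implicit Types (f : V -> R) (x y v : V).

Lemma is_derive_line f y v (t : R) : derivable f (y + t *: v) v ->
  is_derive t 1 (fun s : R => f (y + s *: v)) ('D_v f (y + t *: v)).
Proof.
move=> df; have E : (fun h : R =>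
    h^-1 *: (((fun s : R => f (y + s *: v)) \o shift t) (h *: 1) - f (y + t *: v)))
  = (fun h => h^-1 *: ((f \o shift (y + t *: v)) (h *: v) - f (y + t *: v))).
  apply/funext => h /=; congr (_ *: (f _ - _)).
  by rewrite scalerDl [h *: 1]mulr1 addrCA.
by split; rewrite ?/derivable ?/derive E.
Qed.

(** Reduces statements on directional derivatives to functions of one real
    variable, for which the chain rule is available. *)
Lemma is_derive_lineP f x v (df : R) :
  is_derive x v f df <-> is_derive (0 : R) 1 (fun s : R => f (s *: v + x)) df.
Proof.
have E : (fun h : R =>
    h^-1 *: (((fun s : R => f (s *: v + x)) \o shift 0) (h *: 1) - f ((0 : R) *: v + x)))
  = (fun h : R => h^-1 *: ((f \o shift x) (h *: v) - f x)).
  by apply/funext => h /=; rewrite addr0 scale0r add0r [h *: 1]mulr1.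
by split=> -[fd fD]; split; move: fd fD; rewrite /derivable /derive E.
Qed.

Lemma is_derive_expR_comp f x v (df : R) : is_derive x v f df ->
  is_derive x v (fun y => expR (f y)) (expR (f x) * df).
Proof.
move=> /is_derive_lineP fd; apply/is_derive_lineP.
have := @is_derive1_comp R expR (fun s : R => f (s *: v + x)) 0 (expR (f x)) df.
by apply => //; rewrite scale0r add0r; exact: is_derive_expR.
Qed.

Lemma is_derive_translate f y v w : derivable f (y + w) v ->
  is_derive y v (fun z => f (z + w)) ('D_v f (y + w)).
Proof.
move=> df; have E : (fun h : R =>
    h^-1 *: (((fun z => f (z + w)) \o shift y) (h *: v) - f (y + w)))
  = (fun h => h^-1 *: ((f \o shift (y + w)) (h *: v) - f (y + w))).
  by apply/funext => h /=; rewrite addrA.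
by split; rewrite ?/derivable ?/derive E.
Qed.

(** The intermediate point is only located by its absolute value, so that the sign
    of [t] need not be known. *)
Lemma mean_value f y v (t : R) :
  (forall s, `|s| <= `|t| -> derivable f (y + s *: v) v) ->
  exists2 s, `|s| <= `|t| & f (y + t *: v) - f y = t * 'D_v f (y + s *: v).
Proof.
move=> df; pose g (s : R) := f (y + s *: v).
pose dg (s : R) := 'D_v f (y + s *: v).
have gD (s : R) : `|s| <= `|t| -> is_derive s 1 g (dg s).
  by move=> st; apply/is_derive_line/df.
have gC (a b : R) : (forall s, s \in `[a, b] -> `|s| <= `|t|) ->
    {within `[a, b], continuous g}.
  move=> ab; apply: derivable_within_continuous => s /ab /gD sD.
  exact: ex_derive.
have [t0|t0] := leP 0 t.
  have sub s : s \in `[0, t] -> `|s| <= `|t|.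
    by rewrite in_itv /= => /andP[s0 st]; rewrite !ger0_norm.
  have [s s0t|c ct] := @MVT_segment R g dg 0 t t0 _ (gC _ _ sub).
    by apply: gD; apply: sub; apply: subset_itv_oo_cc.
  by rewrite /g scale0r addr0 subr0 mulrC => E; exists c => //; exact: sub.
have sub s : s \in `[t, 0] -> `|s| <= `|t|.
  by rewrite in_itv /= => /andP[st s0]; rewrite !ler0_norm ?lerN2 // ltW.
have [s s0t|c ct] := @MVT_segment R g dg t 0 (ltW t0) _ (gC _ _ sub).
  by apply: gD; apply: sub; apply: subset_itv_oo_cc.
rewrite /g scale0r addr0 sub0r mulrN => E; exists c; first exact: sub.
by rewrite -opprB E opprK mulrC.
Qed.

End Lines.

Section Several_variables.
Variables (R : realType) (n : nat).
Local Notation point := 'rV[R]_n.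
Local Notation e_ i := (delta_mx 0 i : point).
Implicit Types (f : point -> R) (x y v : point).

Lemma rV_coord_le v i : `|v 0 i| <= `|v|.
Proof. by rewrite [leRHS]/Num.Def.normr/= mx_normrE (le_bigmax _ _ (0, i)). Qed.

Lemma rV_norm_le v a : 0 <= a -> (forall i, `|v 0 i| <= a) -> `|v| <= a.
Proof.
move=> a0 va; rewrite [leLHS]/Num.Def.normr/= mx_normrE bigmax_le // => -[i j] _ /=.
by rewrite ord1.
Qed.

Lemma norm_basis_le i : `|e_ i| <= 1.
Proof.
apply: rV_norm_le => // j; rewrite mxE eqxx /=.
by case: (j == i); rewrite ?normr0 ?normr1.
Qed.

(** The increment is split into [n] steps, each parallel to an axis, and the mean
    value theorem is applied to each of them. *)
Lemma C1_increment f x (eps r : R) :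
  (forall y, `|y| < r -> forall i,
     derivable f (x + y) (e_ i) /\ `|partial i f (x + y) - partial i f x| <= eps) ->
  forall v, `|v| < r ->
    `|f (x + v) - f x - \sum_i v 0 i * partial i f x| <= n%:R * eps * `|v|.
Proof.
move=> fP v vr.
(* the coordinates of [v] are switched on one after the other *)
pose tr k : point := \row_i (if (i < k)%N then v 0 i else 0).
have trS (k : 'I_n) : tr k.+1 = tr k + v 0 k *: e_ k.
  apply/rowP => i; rewrite !mxE eqxx /= ltnS leq_eqVlt -(inj_eq val_inj) /=.
  by case: ltngtP => // [ik|ik|/val_inj ->]; rewrite ?mulr0 ?addr0 ?mulr1 ?add0r.
have trb (k : 'I_n) s : `|s| <= `|v 0 k| -> `|tr k + s *: e_ k| < r.
  move=> sv; apply: le_lt_trans vr; apply: rV_norm_le => // i.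
  rewrite !mxE eqxx /=; have [->|ik] := eqVneq i k.
    by rewrite ltnn add0r mulr1 (le_trans sv) // rV_coord_le.
  by rewrite mulr0 addr0; case: ifP => _; rewrite ?normr0 // rV_coord_le.
have -> : f (x + v) - f x = \sum_(k < n) (f (x + tr k.+1) - f (x + tr k)).
  rewrite -(big_mkord xpredT (fun k => f (x + tr k.+1) - f (x + tr k))).
  rewrite telescope_sumr //; congr (f _ - f _); last first.
    rewrite (_ : tr 0%N = 0) ?addr0 //; apply/rowP => i; by rewrite !mxE.
  by congr (x + _); apply/rowP => i; rewrite mxE ltn_ord.
rewrite -sumrB (le_trans (ler_norm_sum _ _ _)) //.
have -> : n%:R * eps * `|v| = \sum_(k < n) eps * `|v|.
  by rewrite sumr_const card_ord -mulrA mulr_natl.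
apply: ler_sum => k _.
have [s sv|s sv E] := @mean_value R _ f (x + tr k) (e_ k) (v 0 k).
  by rewrite -addrA; have [] := fP _ (trb _ _ sv) k.
rewrite trS addrA E -mulrBr normrM mulrC ler_pM //; last exact: rV_coord_le.
by rewrite -addrA; have [] := fP _ (trb _ _ sv) k.
Qed.

(** Differentiability at [x] takes the existence of the partial derivatives near
    [x], but their continuity at the single point [x]. *)
Definition C1_near f x := forall i,
  (\forall y \near x, derivable f y (e_ i)) /\ {for x, continuous (partial i f)}.

Lemma C1_near_ball f x (eps : R) : C1_near f x -> 0 < eps ->
  exists2 r : R, 0 < r & forall y, `|y| < r -> forall i,
     derivable f (x + y) (e_ i) /\ `|partial i f (x + y) - partial i f x| <= eps.
Proof.
move=> fC eps0.
have : \forall y \near x, forall i,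
    derivable f y (e_ i) /\ `|partial i f y - partial i f x| <= eps.
  apply: (@filter_forall _ _ _ (nbhs x)) => i; have [fd fc] := fC i; near=> y; split.
    by near: y.
  by rewrite distrC; near: y; move/cvgrPdist_le : fc; exact.
move=> /nbhs_ballP[r /= r0 rP]; exists r => // y yr i.
by apply: rP; rewrite -ball_normE /= opprD addNKr normrN.
Unshelve. all: by end_near. Qed.

Lemma linear_form_continuous (a : 'I_n -> R) :
  continuous (fun v : point => \sum_i v 0 i * a i).
Proof.
move=> v; apply: differentiable_continuous.
have -> : (fun v : point => \sum_i v 0 i * a i) = \sum_i (fun v : point => v 0 i * a i).
  by apply/funext => u; rewrite fct_sumE.
apply: differentiable_sum => i; apply: differentiableM => //.
exact: differentiable_coord.
Qed.

Lemma C1_differentiable f x : C1_near f x ->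
  differentiable f x /\ forall v, 'D_v f x = \sum_i v 0 i * partial i f x.
Proof.
move=> fC; pose L v : R := \sum_i v 0 i * partial i f x.
have L_lin : linear L.
  move=> a u v; rewrite /L scaler_sumr -big_split; apply: eq_bigr => i _ /=.
  by rewrite !mxE mulrDl -mulrA.
pose LM := GRing.isLinear.Build _ _ _ _ _ L_lin.
pose Ll : {linear point -> R} := HB.pack L LM.
have L_cont : continuous (L : 'rV[R]_n -> R).
  exact: linear_form_continuous.
have fL : f \o shift x = cst (f x) + Ll +o_ (0 : point) id.
  apply/eqaddoP => _/posnumP[eps].
  have [r r0 rP] := C1_near_ball fC (divr_gt0 [gt0 of eps%:num] (ltr0Sn _ n)).
  apply/nbhs_ballP; exists r => //= v; rewrite -ball_normE /= sub0r normrN => vr.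
  have := C1_increment rP vr; rewrite /= opprD addrA.
  rewrite -![(_ - _ : _ -> _) _]/(_ - _) /= [v + x]addrC => /le_trans; apply.
  rewrite ler_wpM2r // mulrCA ler_piMr // ler_pdivrMr ?ltr0Sn // mul1r.
  by rewrite ler_nat.
have dE : 'd f x = Ll :> (point -> R) by apply: diff_unique.
have df : differentiable f x by apply/diff_locallyP; rewrite dE.
by split=> // v; rewrite deriveE // dE.
Qed.

(** The curve [h |-> G (h v + y)] is differentiable as soon as its coordinates
    are, which reduces the claim to the composition of two differentiable maps. *)
Lemma is_derive_comp_C1 (V : normedModType R) (G : V -> point) f (y v : V) :
  (forall i, derivable (fun z => G z 0 i) y v) -> C1_near f (G y) ->
  is_derive y v (fun z => f (G z))
    (\sum_i 'D_v (fun z => G z 0 i) y * partial i f (G y)).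
Proof.
move=> Gd /C1_differentiable[fd fD].
have Gv : derivable G y v.
  by apply/derivable_mxP => i j; rewrite ord1; exact: Gd.
have Gd0 : differentiable (fun h : R => G (h *: v + y)) 0.
  exact/derivable1_diffP/(@derivable1P R V _ G y v).1.
have fd0 : differentiable f (G ((0 : R) *: v + y)) by rewrite scale0r add0r.
have dfG := differentiable_comp Gd0 fd0.
split; first exact/derivable1P/derivable1_diffP.
have lineE (W : normedModType R) (g : V -> W) :
    'D_v g y = 'D_1 (fun h : R => g (h *: v + y)) 0.
  have E : (fun h : R => h^-1 *: ((g \o shift y) (h *: v) - g y)) = (fun h : R =>
      h^-1 *: (((fun k : R => g (k *: v + y)) \o shift 0) (h *: 1) - g ((0 : R) *: v + y))).
    by apply/funext => h /=; rewrite addr0 scale0r add0r [h *: 1]mulr1.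
  by rewrite /derive E.
rewrite lineE deriveE // (diff_comp Gd0 fd0) /= scale0r add0r -(deriveE _ Gd0).
rewrite -lineE -deriveE // fD; apply: eq_bigr => i _.
by rewrite (derive_mx Gv) mxE.
Qed.

Lemma near_line (P : set point) x v : (\forall y \near x, P y) ->
  exists2 r : R, 0 < r & forall s, `|s| < r -> P (x + s *: v).
Proof.
move=> /nbhs_ballP[r /= r0 rP].
have v0 : 0 < `|v| + 1 by rewrite ltr_wpDl.
exists (r / (`|v| + 1)); first by rewrite divr_gt0.
move=> s sr; apply: rP; rewrite -ball_normE /= opprD addNKr normrN normrZ.
rewrite ltr_pdivlMr // in sr; apply: le_lt_trans sr.
by rewrite ler_wpM2l // lerDl.
Qed.

(** The second difference of [f] over a small square equals its area times either
    mixed derivative, each at some point of the square. *)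
Theorem Schwarz f x i j : C1_near f x -> C1_near (partial i f) x ->
  C1_near (partial j f) x -> partial i (partial j f) x = partial j (partial i f) x.
Proof.
move=> fC fiC fjC; apply/subr0_eq/normr0_eq0/le_anti; rewrite normr_ge0 andbT.
apply/ler_addgt0Pl => eps eps0; rewrite addr0.
have [r0 r00 r0P] := C1_near_ball fC eps0.
have eps2 : 0 < eps / 2 by rewrite divr_gt0.
have [r1 r10 r1P] := C1_near_ball fiC eps2.
have [r2 r20 r2P] := C1_near_ball fjC eps2.
pose r := Num.min r0 (Num.min r1 r2).
have r_gt0 : 0 < r by rewrite !lt_min r00 r10.
(* the corner of the square of side [t] stays in the ball of radius [r] *)
pose t := r / 3; have t0 : 0 < t by rewrite divr_gt0.
have tr : t + t < r by rewrite /t; lra.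
have small s u (k l : 'I_n) : `|s| <= `|t| -> `|u| <= `|t| ->
    `|s *: e_ k + u *: e_ l| < r.
  rewrite (gtr0_norm t0) => st ut; apply: le_lt_trans tr.
  rewrite (le_trans (ler_normD _ _)) // !normrZ lerD //.
    by rewrite (le_trans _ st) // ler_piMr // norm_basis_le.
  by rewrite (le_trans _ ut) // ler_piMr // norm_basis_le.
have [rr0 rr1 rr2] : [/\ r <= r0, r <= r1 & r <= r2].
  by rewrite /r; split; rewrite !ge_min lexx ?orbT.
(* the second difference of f, computed with the derivatives in either order *)
have key k l : (forall y, `|y| < r -> derivable f (x + y) (e_ k)) ->
    (forall y, `|y| < r -> derivable (partial k f) (x + y) (e_ l)) ->
    exists2 z, `|z| < r &
      f (x + t *: e_ k + t *: e_ l) - f (x + t *: e_ k) - (f (x + t *: e_ l) - f x)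
      = t * (t * partial l (partial k f) (x + z)).
  move=> kP klP; pose g y := f (y + t *: e_ l) - f y.
  have gd s : `|s| <= `|t| -> is_derive (x + s *: e_ k) (e_ k) g
      (partial k f (x + s *: e_ k + t *: e_ l) - partial k f (x + s *: e_ k)).
    move=> st; apply: is_derive_sub; last first.
      apply: derivableP; apply: kP; have := small s 0 k l st.
      by rewrite scale0r addr0 normr0; apply; rewrite normr_ge0.
    by apply: is_derive_translate; rewrite -addrA; apply/kP/small.
  have [s st|s st E] := @mean_value R _ g x (e_ k) t.
    by have := gd s st => ?; exact: ex_derive.
  have [u ut|u ut F] := @mean_value R _ (partial k f) (x + s *: e_ k) (e_ l) t.
    by rewrite -addrA; apply/klP/small.
  exists (s *: e_ k + u *: e_ l); first exact: small.
  by rewrite -/(g _) -/(g x) E (@derive_val _ _ _ _ _ _ _ (gd s st)) F addrA.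
have fd y k : `|y| < r -> derivable f (x + y) (e_ k).
  by move=> yr; have [] := r0P y (lt_le_trans yr rr0) k.
have [u ur Eu] := key i j (fd^~ i) (fun y yr => (r1P y (lt_le_trans yr rr1) j).1).
have [w wr Ew] := key j i (fd^~ j) (fun y yr => (r2P y (lt_le_trans yr rr2) i).1).
have [_ Bu] := r1P u (lt_le_trans ur rr1) j.
have [_ Bw] := r2P w (lt_le_trans wr rr2) i.
have tn0 : t != 0 by rewrite gt_eqF.
have uw : partial j (partial i f) (x + u) = partial i (partial j f) (x + w).
  apply: (mulfI tn0); apply: (mulfI tn0); rewrite -Eu -Ew.
  by rewrite [x + _ + _]addrAC; ring.
rewrite [eps]splitr; move: Bu Bw; rewrite uw => Bu Bw.
rewrite -[X in `|X|](subrKA (partial i (partial j f) (x + w))).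
apply: le_trans (ler_normD _ _) _; apply: lerD; last exact: Bu.
by rewrite distrC; exact: Bw.
Qed.

End Several_variables.

(** * Derivatives of determinants and inverse matrices *)

Section Matrices.
Variables (R : realType) (V : normedModType R).
Implicit Types (x v : V).

Lemma is_derive_prod n (F : 'I_n -> V -> R) (dF : 'I_n -> R) x v :
  (forall i, is_derive x v (F i) (dF i)) ->
  is_derive x v (fun y => \prod_i F i y)
    (\sum_k \prod_i (if i == k then dF i else F i x)).
Proof.
elim: n F dF => [|n IH] F dF Fd.
  rewrite big_ord0 (_ : (fun y => _) = fun=> 1); first exact: is_derive_const.
  by apply/funext => y; rewrite big_ord0.
rewrite (_ : (fun y => _) = fun y => F ord0 y * \prod_i F (lift ord0 i) y); last first.
  by apply/funext => y; rewrite big_ord_recl.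
apply: is_derive_eq; first exact: is_derive_mul (Fd _) (IH _ _ (fun i => Fd (lift ord0 i))).
rewrite [RHS]big_ord_recl big_ord_recl eqxx; congr (_ * _ + _).
rewrite mulr_sumr; apply: eq_bigr => k _; rewrite big_ord_recl; congr (_ * _).
Qed.

(** The Leibniz formula makes the derivative a sum, over the rows, of determinants
    in which one row is differentiated; each is expanded along that row. *)
Lemma is_derive_det n (A : V -> 'M[R]_n) (dA : 'M[R]_n) x v :
  (forall i j, is_derive x v (fun y => A y i j) (dA i j)) ->
  is_derive x v (fun y => \det (A y)) (\sum_k \sum_j dA k j * cofactor (A x) k j).
Proof.
move=> Ad; rewrite /determinant; apply: is_derive_eq.
  apply: is_derive_bigsum => s; apply: is_derive_scale.
  by apply: is_derive_prod => i; exact: Ad.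
under eq_bigr do rewrite mulr_sumr.
rewrite exchange_big; apply: eq_bigr => k _ /=.
(* only row [k] is differentiated *)
pose B := (\matrix_(i, j) if i == k then dA i j else A x i j) : 'M[R]_n.
transitivity (\det B).
  by apply: eq_bigr => s _; congr (_ * _); apply: eq_bigr => i _; rewrite mxE.
rewrite (expand_det_row _ k); apply: eq_bigr => j _; rewrite mxE eqxx; congr (_ * _).
rewrite /cofactor; congr (_ * \det _); apply/matrixP => a b.
by rewrite !mxE eq_sym (negbTE (neq_lift k a)).
Qed.

Lemma is_derive_det_unit n (A : V -> 'M[R]_n) (dA : 'M[R]_n) x v : A x \in unitmx ->
  (forall i j, is_derive x v (fun y => A y i j) (dA i j)) ->
  is_derive x v (fun y => \det (A y))
    (\det (A x) * (\sum_j \sum_k invmx (A x) j k * dA k j)).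
Proof.
move=> Au /is_derive_det Ad; apply: is_derive_eq Ad _.
rewrite exchange_big mulr_sumr; apply: eq_bigr => j _ /=.
rewrite mulr_sumr; apply: eq_bigr => k _.
rewrite [RHS]mulrA [LHS]mulrC; congr (_ * _).
by rewrite /invmx Au !mxE mulVKr // -unitmxE.
Qed.

Lemma is_derive_inv x v (f : V -> R) df : f x != 0 -> is_derive x v f df ->
  exists d, is_derive x v (fun y => (f y)^-1) d.
Proof.
move=> f0 fd; exists ('D_v (fun y => (f y)^-1) x).
by apply/derivableP/derivableV => //; exact: ex_derive.
Qed.

(** Cramer's rule shows that the derivative exists; its value follows by
    differentiating [A A^-1 = 1]. *)
Lemma is_derive_invmx n (A : V -> 'M[R]_n) (dA : 'M[R]_n) (P : set V) x v :
  open P -> P x -> (forall y, P y -> A y \in unitmx) ->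
  (forall i j, is_derive x v (fun y => A y i j) (dA i j)) ->
  forall i j, is_derive x v (fun y => invmx (A y) i j)
    (- \sum_a \sum_b invmx (A x) i a * dA a b * invmx (A x) b j).
Proof.
move=> Po Px Au Ad i j.
have /choice[dI IE] : forall k : 'I_n * 'I_n, exists d,
    is_derive x v (fun y => invmx (A y) k.1 k.2) d.
  case=> k l /=.
  have cd : exists d, is_derive x v (fun y => cofactor (A y) l k) d.
    eexists; apply: is_derive_scale; apply: (is_derive_det (dA := row' l (col' k dA))) => a b.
    rewrite !mxE; under eq_fun do rewrite !mxE.
    exact: Ad.
  have [d1 d1P] := cd.
  have det0 : \det (A x) != 0 by rewrite -unitfE -unitmxE Au.
  have [d2 d2P] := is_derive_inv det0 (is_derive_det Ad).
  exists (d2 * cofactor (A x) l k + (\det (A x))^-1 * d1).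
  apply: (is_derive_ext_near Po Px _ (is_derive_mul d2P d1P)) => y Py.
  by rewrite /invmx Au // !mxE.
pose B k l := dI (k, l).
have BP k l : is_derive x v (fun y => invmx (A y) k l) (B k l) by exact: (IE (k, l)).

have AB : dA *m invmx (A x) + A x *m (\matrix_(k, l) B k l) = 0.
  apply/matrixP => k l; rewrite !mxE.
  have H : is_derive x v (fun y => (A y *m invmx (A y)) k l)
      (\sum_a (dA k a * invmx (A x) a l + A x k a * B a l)).
    rewrite (_ : (fun y => _) = fun y => \sum_a A y k a * invmx (A y) a l).
      by apply: is_derive_bigsum => a; exact: is_derive_mul.
    by apply/funext => y; rewrite mxE.
  have H1 : is_derive x v (fun y => (A y *m invmx (A y)) k l) 0.
    apply: (is_derive_ext_near Po Px _ (is_derive_const x v ((1%:M : 'M[R]_n) k l))) => y Py.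
    by rewrite mulmxV ?Au.
  transitivity (\sum_a (dA k a * invmx (A x) a l + A x k a * B a l)).
    by rewrite big_split; congr (_ + _); apply: eq_bigr => a _; rewrite mxE.
  by rewrite -(@derive_val _ _ _ _ _ _ _ H) (@derive_val _ _ _ _ _ _ _ H1).
have := congr1 (fun M => (invmx (A x) *m M) i j) AB; rewrite mulmxDr mulKmx ?Au //.
rewrite mulmx0 [RHS]mxE [LHS]mxE => /eqP; rewrite addr_eq0 eq_sym eqr_oppLR => /eqP.
rewrite mxE mulmxA => E; apply: is_derive_eq (BP i j) _; rewrite E; congr (- _).
rewrite exchange_big mxE; apply: eq_bigr => b _; rewrite mxE mulr_suml.
by apply: eq_bigr.
Qed.

End Matrices.

(** * Convex functions and positive semidefinite matrices *)

Lemma continuous_lincomb (R : realType) (T : topologicalType) (I : Type) (r : seq I)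
    (a : I -> R) (F : I -> T -> R) (x : T) :
  (forall i, {for x, continuous (F i)}) ->
  {for x, continuous (fun y => \sum_(i <- r) a i * F i y)}.
Proof.
move=> Fc; apply: (@cvg_big _ _ +%R) => [|i _]; first exact: add_continuous.
by apply: cvgMl_tmp; exact: Fc.
Qed.

Section Convexity.
Variables (R : realType) (n : nat).
Local Notation point := 'rV[R]_n.
Implicit Types (f : point -> R) (x y v : point).

(** If the quadratic form of the Hessian were negative in the direction [u], it
    would be so near [x], and two applications of the mean value theorem would
    make [f (x + t u) - 2 f x + f (x - t u)] negative for small [t]. *)
Lemma convex_hess_ge0 (Omega : set point) f x (u : point) : open Omega ->
  (forall y, Omega y -> C1_near f y) ->
  (forall y i, Omega y -> C1_near (partial i f) y) ->
  (forall i j, {for x, continuous (D2 f i j)}) ->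
  convex_function Omega f -> Omega x ->
  0 <= \sum_i \sum_j hess f x i j * u 0 i * u 0 j.
Proof.
move=> Oo fC fiC fjC f_convex Ox.
pose psi y := \sum_i u 0 i * partial i f y.
pose q y := \sum_i u 0 i * (\sum_j u 0 j * D2 f j i y).
have fu y : Omega y -> is_derive y u f (psi y).
  move=> /fC/C1_differentiable[fd fD]; rewrite /psi -fD.
  apply: derivableP; exact: diff_derivable.
have psiu y : Omega y -> is_derive y u psi (q y).
  move=> Oy; apply: is_derive_bigsum => i; apply: is_derive_scale.
  have [fd fD] := C1_differentiable (fiC y i Oy).
  have -> : \sum_j u 0 j * D2 f j i y = 'D_u (partial i f) y by rewrite fD.
  apply: derivableP; exact: diff_derivable.
have -> : \sum_i \sum_j hess f x i j * u 0 i * u 0 j = q x.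
  rewrite exchange_big; apply: eq_bigr => j _; rewrite mulr_sumr.
  by apply: eq_bigr => i _; rewrite mxE; ring.
have qC : {for x, continuous q}.
  by apply: continuous_lincomb => i; apply: continuous_lincomb => j; exact: fjC.
rewrite leNgt; apply/negP => q0.
have nearx : \forall y \near x, Omega y /\ q y < 0.
  near=> y; split; first by near: y; exact: open_nbhs_nbhs.
  by near: y; apply: (cvgr_lt (q x)).
have [r r0 rP] := near_line u nearx.
(* the two mean values are taken at distance at most [3 t] from [x] *)
pose t := r / 4; have t0 : 0 < t by rewrite divr_gt0.
have sP s : `|s| <= 3 * t -> Omega (x + s *: u) /\ q (x + s *: u) < 0.
  by move=> st; apply: rP; apply: le_lt_trans st _; rewrite /t; lra.
have Ox1 : Omega (x + t *: u) by have [|//] := sP t; rewrite gtr0_norm //; lra.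
have Oy : Omega (x + (- t) *: u) by have [|//] := sP (- t); rewrite normrN gtr0_norm //; lra.
(* [g x - g y] is the symmetric second difference of [f] at [x] *)
pose y := x + (- t) *: u; pose g z := f (z + t *: u) - f z.
have gE z a : x + a *: u = z -> `|a| <= 2 * t ->
    is_derive z u g (psi (z + t *: u) - psi z).
  move=> <- at2; have [Oz _] : Omega (x + a *: u) /\ q (x + a *: u) < 0.
    by apply: sP; lra.
  apply: is_derive_sub; last exact: fu.
  have [Oz' _] : Omega (x + (a + t) *: u) /\ q (x + (a + t) *: u) < 0.
    by apply: sP; rewrite (le_trans (ler_normD _ _)) // (gtr0_norm t0); lra.
  rewrite scalerDl addrA in Oz'; have fz := fu _ Oz'.
  rewrite -(@derive_val _ _ _ _ _ _ _ fz); apply: is_derive_translate.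
  exact: ex_derive.
have shiftE s : y + s *: u = x + (s - t) *: u.
  by rewrite /y -addrA -scalerDl [- t + s]addrC.
have bnd s : `|s| <= `|t| -> `|s - t| <= 2 * t.
  rewrite (gtr0_norm t0) => st; rewrite (le_trans (ler_normB _ _)) // (gtr0_norm t0); lra.
have [s st|s st E] := @mean_value R _ g y u t.
  have gd := gE (y + s *: u) (s - t) (esym (shiftE s)) (bnd _ st).
  exact: ex_derive.
have [w wt|w wt F] := @mean_value R _ psi (y + s *: u) u t.
  rewrite shiftE -addrA -scalerDl; have [|Oz _] := sP (s - t + w).
    rewrite (le_trans (ler_normD _ _)) //; have := bnd _ st.
    by move: wt; rewrite (gtr0_norm t0); lra.
  by have := psiu _ Oz => ?; exact: ex_derive.
have [|Oz qz] := sP (s - t + w).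
  rewrite (le_trans (ler_normD _ _)) //; have := bnd _ st.
  by move: wt; rewrite (gtr0_norm t0); lra.
have Ez : y + s *: u + w *: u = x + (s - t + w) *: u.
  by rewrite shiftE -addrA -scalerDl.
rewrite Ez (@derive_val _ _ _ _ _ _ _ (psiu _ Oz)) in F.
have gd := gE (y + s *: u) (s - t) (esym (shiftE s)) (bnd _ st).
rewrite (@derive_val _ _ _ _ _ _ _ gd) F in E.
have lt0 : f (x + t *: u) - f x - (f x - f y) < 0.
  have <- : g (y + t *: u) - g y = f (x + t *: u) - f x - (f x - f y).
    by rewrite /g shiftE subrr scale0r addr0.
  by rewrite E mulrA pmulr_rlt0 // mulr_gt0.
have h0 : 0 <= (2^-1 : R) by rewrite invr_ge0 ler0n.
have h1 : (2^-1 : R) <= 1 by rewrite invf_le1 ?ler1n ?ltr0n.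
have := f_convex (Itv01 h0 h1) (x + t *: u) y; rewrite !inE => /(_ Ox1 Oy).
rewrite -[X in _ <= X]/(2^-1 * f (x + t *: u) + (1 - 2^-1) * f y).
have -> : conv (Itv01 h0 h1) (x + t *: u : convex_lmodType 'rV[R]_n) y = x.
  change (2^-1 *: (x + t *: u) + (1 - 2^-1) *: y = x).
  have -> : 1 - 2^-1 = 2^-1 :> R by rewrite {1}(splitr 1) mul1r addrK.
  rewrite -scalerDr /y addrACA scaleNr subrr addr0 -mulr2n -[x *+ 2]scaler_nat scalerA.
  by rewrite mulVf ?pnatr_eq0 // scale1r.
move: lt0; move: (f (x + t *: u)) (f y) (f x) => p p' m; clear => lt0.
have -> : 1 - 2^-1 = 2^-1 :> R by rewrite {1}(splitr 1) mul1r addrK.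
by move: lt0; lra.
Unshelve. all: by end_near. Qed.

End Convexity.

Section Positive_semidefinite.
Variable (R : realType).

Definition psd n (M : 'M[R]_n) : Prop := forall u : 'rV_n, 0 <= (u *m M *m u^T) 0 0.

Lemma psd_block n (a : R) (b : 'rV[R]_n) (D : 'M[R]_n) (s : R) (u : 'rV[R]_n) :
  let w : 'rV_(1 + n) := row_mx s%:M u in
  (w *m block_mx a%:M b b^T D *m w^T) 0 0 =
  s ^+ 2 * a + s * (u *m b^T) 0 0 *+ 2 + (u *m D *m u^T) 0 0.
Proof.
rewrite /= mul_row_block tr_row_mx mul_row_col tr_scalar_mx !mulmxDl.
have -> : s%:M *m b *m u^T = s *: (u *m b^T).
  rewrite mul_scalar_mx -scalemxAl -[b *m u^T]trmxK trmx_mul trmxK.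
  by rewrite [(u *m b^T)^T]mx11_scalar mxE -mx11_scalar.
rewrite !mul_mx_scalar; move: (u *m b^T) (u *m D *m u^T) => B G.
by rewrite !mxE eqxx /=; ring.
Qed.

(** Completion of the square in the first coordinate: the Schur complement of the
    first diagonal entry is again positive semidefinite.  If that entry vanishes,
    so does its row. *)
Lemma psd_factor n (M : 'M[R]_n) : M^T = M -> psd M -> exists A : 'M[R]_n, M = A^T *m A.
Proof.
elim: n M => [|n IH] M; first by exists 0; apply/matrixP => -[].
rewrite -[n.+1]/(1 + n)%N in M *; move=> Msym Mpsd.
pose a := (ulsubmx M 0 0 : R); pose b := (ursubmx M : 'rV[R]_n);
  pose D := (drsubmx M : 'M[R]_n).
have ME : M = block_mx a%:M b b^T D.
  by rewrite -[LHS]submxK -mx11_scalar /b trmx_ursub Msym.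
have DT : D^T = D by rewrite /D trmx_drsub Msym.
have Q (s : R) (u : 'rV[R]_n) :
    0 <= s ^+ 2 * a + s * (u *m b^T) 0 0 *+ 2 + (u *m D *m u^T) 0 0.
  by have := psd_block a b D s u; rewrite /= -ME => <-; exact: Mpsd.
clearbody a b D.
have a0 : 0 <= a.
  by have := Q 1 0; rewrite !mul0mx mxE mulr0 mul0rn !addr0 expr1n mul1r.
move: a0; rewrite le_eqVlt => /orP[/eqP a0|a0].
  have b0 : b = 0.
    pose c := (b *m b^T) 0 0; pose d := (b *m D *m b^T) 0 0.
    have cE : c = \sum_i b 0 i ^+ 2.
      by rewrite /c mxE; apply: eq_bigr => i _; rewrite mxE expr2.
    have c0 : 0 <= c by rewrite cE sumr_ge0 // => i _; rewrite sqr_ge0.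
    have : c == 0.
      rewrite eq_le c0 andbT leNgt; apply/negP => c_gt0.
      (* this multiple makes the cross term exceed the last term *)
      have := Q (- (d + 1) / c) b; rewrite -a0 mulr0 add0r -/c -/d divfK ?gt_eqF //.
      have := Q 0 b; rewrite expr0n mul0r add0r mul0r mul0rn add0r -/d.
      by lra.
    rewrite cE psumr_eq0 => [/allP b0|i _]; last exact: sqr_ge0.
    apply/rowP => i; rewrite mxE; apply/eqP; rewrite -sqrf_eq0.
    by apply: b0; rewrite mem_index_enum.
  have Dpsd : psd D by move=> u; have := Q 0 u; rewrite expr0n mul0r add0r mul0r mul0rn add0r.
  have [A AE] := IH D DT Dpsd; exists (block_mx 0 0 0 A).
  rewrite ME -a0 b0 AE tr_block_mx mulmx_block !trmx0 !mulmx0 !mul0mx !addr0.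
  by rewrite add0r raddf0.
pose D' := D - a^-1 *: (b^T *m b).
have D'T : D'^T = D' by rewrite /D' linearB linearZ /= trmx_mul trmxK DT.
have D'psd : psd D'.
  (* [- c / a] minimizes the form with respect to the first coordinate *)
  move=> u; pose c := (u *m b^T) 0 0; have := Q (- c / a) u; rewrite -/c.
  have -> : (u *m D' *m u^T) 0 0 = (u *m D *m u^T) 0 0 - a^-1 * c ^+ 2.
    have -> : u *m D' *m u^T = u *m D *m u^T - a^-1 *: ((u *m b^T) *m (u *m b^T)^T).
      by rewrite trmx_mul trmxK /D' mulmxBr mulmxBl -scalemxAr -scalemxAl !mulmxA.
    by rewrite mxE; congr (_ + _); rewrite !mxE big_ord1 [_^T _ _]mxE -/c expr2.
  suff -> : (- c / a) ^+ 2 * a + - c / a * c *+ 2 = - (a^-1 * c ^+ 2).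
    by rewrite addrC.
  by field; rewrite gt_eqF.
have [A AE] := IH D' D'T D'psd.
have ra : Num.sqrt a != 0 by rewrite sqrtr_eq0 -ltNge.
set r := Num.sqrt a in ra *; have rr : r ^+ 2 = a by rewrite sqr_sqrtr ?ltW.
have E1 : (r%:M : 'M[R]_1) *m r%:M = a%:M by rewrite -scalar_mxM -expr2 rr.
have E2 : r%:M *m (r^-1 *: b) = b by rewrite mul_scalar_mx scalerA mulfV ?scale1r.
have E3 : (r^-1 *: b)^T *m r%:M = b^T.
  by rewrite -[LHS]trmxK trmx_mul trmxK tr_scalar_mx E2.
have E4 : (r^-1 *: b)^T *m (r^-1 *: b) = a^-1 *: (b^T *m b).
  have -> : (r^-1 *: b)^T = r^-1 *: b^T by rewrite linearZ.
  by rewrite -scalemxAl -scalemxAr scalerA -invfM -expr2 rr.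
exists (block_mx r%:M (r^-1 *: b) 0 A).
rewrite ME tr_block_mx mulmx_block tr_scalar_mx E1 E2 E3 E4 -AE trmx0.
by rewrite !mulmx0 !mul0mx !addr0 addrC /D' subrK.
Qed.

End Positive_semidefinite.

(** * Deciding identities between contracted products of symmetric tensors *)

Inductive symbol := Hinv | DPhi | DW.
Definition nat_of_symbol s := match s with Hinv => 0%N | DPhi => 1%N | DW => 2%N end.
Definition symbol_of_nat n := match n with 0%N => Hinv | 1%N => DPhi | _ => DW end.
Lemma nat_of_symbolK : cancel nat_of_symbol symbol_of_nat. Proof. by case. Qed.
HB.instance Definition _ := Equality.copy symbol (can_type nat_of_symbolK).

Definition atom := (symbol * seq nat)%type.

(** The second argument of [Atom] lists the indices of a tensor.  Indices are
    counted from the innermost enclosing [Sum] outwards, and then through the free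
    indices. *)
Inductive expr :=
| Atom of symbol & seq nat
| Const of nat
| Half
| Opp of expr
| Add of expr & expr
| Mul of expr & expr
| Sum of expr.

(** [(z, k)] stands for [z / 2 ^ k]: halving is the only division that occurs in
    the Christoffel symbols and in the curvature. *)
Definition dyadic := (int * nat)%type.

(** A coefficient, the number [k] of summed indices, and the factors.  The indices
    below [k] are the summed ones, so that an enclosing [Sum] changes nothing but
    this number. *)
Definition monomial := (dyadic * (nat * seq atom))%type.

Definition mul_dyadic (c d : dyadic) : dyadic := (c.1 * d.1, (c.2 + d.2)%N).
Definition add_dyadic (c d : dyadic) : dyadic :=
  let m := maxn c.2 d.2 in
  (c.1 * 2 ^+ (m - c.2) + d.1 * 2 ^+ (m - d.2), m).

Definition shift_atom (f : nat -> nat) (a : atom) : atom := (a.1, map f a.2).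

Definition mul_monomial (m1 m2 : monomial) : monomial :=
  let: (c1, (k1, s1)) := m1 in let: (c2, (k2, s2)) := m2 in
  (mul_dyadic c1 c2, ((k1 + k2)%N,
   map (shift_atom (addn k2)) s1 ++
   map (shift_atom (fun j => if (j < k2)%N then j else (j + k1)%N)) s2)).

Fixpoint normal_form (e : expr) : seq monomial :=
  match e with
  | Atom s ix => [:: ((1, 0%N), (0%N, [:: (s, ix)]))]
  | Const n => [:: ((n%:Z, 0%N), (0%N, [::]))]
  | Half => [:: ((1, 1%N), (0%N, [::]))]
  | Opp e => map (fun m : monomial => ((- m.1.1, m.1.2), m.2)) (normal_form e)
  | Add e f => normal_form e ++ normal_form f
  | Mul e f => allpairs mul_monomial (normal_form e) (normal_form f)
  | Sum e => map (fun m : monomial => (m.1, (m.2.1.+1, m.2.2))) (normal_form e)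
  end.

Definition partial_ren := seq (option nat).

(** Extends an injective partial renaming of the summed indices by [u |-> v]; free
    indices may only be matched with themselves. *)
Definition bind_slot (k : nat) (r : partial_ren) (u v : nat) : option partial_ren :=
  if (u < k)%N then
    if (v < k)%N then
      match nth None r u with
      | Some w => if w == v then Some r else None
      | None => if Some v \in r then None else Some (set_nth None r u (Some v))
      end
    else None
  else if u == v then Some r else None.

Fixpoint first_some {A B} (f : A -> option B) (s : seq A) : option B :=
  if s is x :: s' then (if f x is Some y then Some y else first_some f s') else None.

Fixpoint selections {A} (s : seq A) : seq (A * seq A) :=
  if s is x :: s' then (x, s') :: map (fun p => (p.1, x :: p.2)) (selections s') else [::].

(** Backtracking reaches across the factors through the continuation: a choice
    made for the indices of one factor may only fail in a later one. *)
Fixpoint match_slots k (us vs : seq nat) (r : partial_ren)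
  (cont : partial_ren -> option partial_ren) : option partial_ren :=
  if us is u :: us' then
    first_some (fun p =>
      if bind_slot k r u p.1 is Some r' then match_slots k us' p.2 r' cont else None)
      (selections vs)
  else cont r.

Fixpoint match_atoms k (s t : seq atom) (r : partial_ren) : option partial_ren :=
  if s is a :: s' then
    first_some (fun p : atom * seq atom =>
      if (p.1.1 == a.1) && (size p.1.2 == size a.2) then
        match_slots k a.2 p.1.2 r (match_atoms k s' p.2)
      else None) (selections t)
  else Some r.

Definition unseen k (known : seq nat) (a : atom) :=
  size [seq j <- a.2 | (j < k)%N && (j \notin known)].

(** The factor with the fewest summed indices not seen before comes next.  Most of
    its indices are then determined, which keeps the backtracking short. *)
Fixpoint order_atoms fuel k known (s : seq atom) : seq atom :=
  if fuel is f.+1 then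
    if s is a0 :: s' then
      let p := foldl (fun b p =>
        if (unseen k known p.1 < unseen k known b.1)%N then p else b)
        (a0, s') (selections s) in
      p.1 :: order_atoms f k (p.1.2 ++ known) p.2
    else [::]
  else [::].

(** The search may be incomplete or wrong without harm, as [alpha_equiv] verifies
    the renaming that it returns. *)
Definition find_ren k (s t : seq atom) : option (seq nat) :=
  omap (map (odflt 0%N)) (match_atoms k (order_atoms (size s) k [::] s) t (nseq k None)).

Definition sort_atom (a : atom) : atom := (a.1, sort leq a.2).
Definition rename k (r : seq nat) (j : nat) := if (j < k)%N then nth 0%N r j else j.

(** An invariant under renaming; comparing it first rejects most pairs of monomials
    at once. *)
Definition profile (s : seq atom) : seq nat :=
  sort leq [seq (10 * nat_of_symbol a.1 + size a.2)%N | a <- s].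

Definition alpha_equiv (m1 m2 : nat * seq atom) : bool :=
  let: (k1, s1) := m1 in let: (k2, s2) := m2 in
  [&& k1 == k2, profile s1 == profile s2 &
  if find_ren k1 s1 s2 is Some r then
    perm_eq r (iota 0 k1) &&
    perm_eq (map sort_atom (map (shift_atom (rename k1 r)) s1)) (map sort_atom s2)
  else false].

Fixpoint collect_like fuel (l : seq monomial) : seq monomial :=
  if fuel is f.+1 then
    if l is m :: l' then
      let same := [seq x <- l' | alpha_equiv x.2 m.2] in
      let other := [seq x <- l' | ~~ alpha_equiv x.2 m.2] in
      let c := foldr (fun x : monomial => add_dyadic x.1) m.1 same in
      if c.1 == 0 then collect_like f other else (c, m.2) :: collect_like f other
    else [::]
  else l.

Definition tensor_identity e1 e2 : bool :=
  let l := normal_form (Add e1 (Opp e2)) in nilp (collect_like (size l) l).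

Section Semantics.
Variables (R : numFieldType) (n : nat) (i0 : 'I_n).
Variable A : symbol -> seq 'I_n -> R.
Hypothesis A_sym : forall s ix iy, perm_eq ix iy -> A s ix = A s iy.

Fixpoint interp (env : seq 'I_n) (e : expr) : R :=
  match e with
  | Atom s ix => A s [seq nth i0 env j | j <- ix]
  | Const k => k%:R
  | Half => 2^-1
  | Opp e => - interp env e
  | Add e f => interp env e + interp env f
  | Mul e f => interp env e * interp env f
  | Sum e => \sum_c interp (c :: env) e
  end.

(** The outermost summation fills the last place of the tuple, in accordance with
    the numbering of the indices in [expr]. *)
Fixpoint sumk k (F : seq 'I_n -> R) : R :=
  if k is k'.+1 then \sum_c sumk k' (fun b => F (rcons b c)) else F [::].

Lemma eq_sumk k F G :
  (forall b, size b = k -> F b = G b) -> sumk k F = sumk k G.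
Proof.
elim: k F G => [|k IH] F G eqFG; first exact: eqFG.
by apply: eq_bigr => c _; apply: IH => b sb; apply: eqFG; rewrite size_rcons sb.
Qed.

Lemma sumkZ k F a : sumk k (fun b => a * F b) = a * sumk k F.
Proof.
elim: k F => [//|k IH] F; rewrite mulr_sumr; apply: eq_bigr => c _.
exact: IH.
Qed.

Lemma sumk_add k1 k2 F :
  sumk (k1 + k2)%N F = sumk k1 (fun b1 => sumk k2 (fun b2 => F (b2 ++ b1))).
Proof.
elim: k1 F => [|k1 IH] F /=.
  by apply: eq_sumk => b _; rewrite cats0.
apply: eq_bigr => c _; rewrite IH; apply: eq_sumk => b1 _.
by apply: eq_sumk => b2 _; rewrite rcons_cat.
Qed.

Lemma sumk_tuple k F : sumk k F = \sum_(t : k.-tuple 'I_n) F t.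
Proof.
elim: k F => [|k IH] F /=.
  rewrite (big_pred1 [tuple]) // => -[[|//] st] /=.
  by apply/esym/eqP/val_inj.
under eq_bigr do rewrite IH.
rewrite pair_bigA /=.
rewrite (reindex (fun p : 'I_n * k.-tuple 'I_n => [tuple of rcons p.2 p.1])) //=.
pose g (t : k.+1.-tuple 'I_n) : 'I_n * k.-tuple 'I_n :=
  (last i0 t, [tuple nth i0 t (val j) | j < k]).
have mapn (s : seq 'I_n) : size s = k ->
    [seq nth i0 s (val j) | j <- enum 'I_k] = s.
  move=> <-; rewrite -[RHS](mkseq_nth i0) /mkseq -val_enum_ord -map_comp.
  by [].
exists g => [[c t] _|t _].
  congr pair; rewrite /= ?last_rcons //; apply: val_inj => /=.
  rewrite -[RHS]mapn ?size_tuple //; apply: eq_map => j.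
  by rewrite nth_rcons size_tuple ltn_ord.
apply: val_inj; case: t => s /= /eqP; case/lastP: s => [//|s c].
rewrite size_rcons => -[ss]; rewrite last_rcons; congr rcons.
rewrite -[RHS]mapn //; apply: eq_map => j /=.
by rewrite nth_rcons ss ltn_ord.
Qed.

(** Renaming the summed indices by a permutation is a bijection of the index
    tuples. *)
Lemma sumk_perm k r F : perm_eq r (iota 0 k) ->
  sumk k (fun b => F [seq nth i0 b j | j <- r]) = sumk k F.
Proof.
move=> rP; have sr : size r = k by rewrite (perm_size rP) size_iota.
rewrite !sumk_tuple; have st t : size [seq nth i0 t j | j <- r] == k.
  by rewrite size_map sr.
rewrite [RHS](reindex_inj (h := fun t : k.-tuple 'I_n => Tuple (st t))) //.
move=> t u /(congr1 val) /= /eq_in_map E; apply/val_inj.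
apply: (@eq_from_nth _ i0) => [|j]; rewrite ?size_tuple // => jk.
by apply: E; rewrite (perm_mem rP) mem_iota.
Qed.

Definition eval_atoms (env : seq 'I_n) (s : seq atom) : R :=
  \prod_(a <- s) A a.1 [seq nth i0 env j | j <- a.2].
Definition eval_dyadic (c : dyadic) : R := c.1%:~R / 2 ^+ c.2.
Definition eval_body env (m : nat * seq atom) : R :=
  sumk m.1 (fun b => eval_atoms (b ++ env) m.2).
Definition eval_monomial env (m : monomial) : R := eval_dyadic m.1 * eval_body env m.2.

Lemma eval_atoms_shift f env env' s :
  (forall j, nth i0 env' (f j) = nth i0 env j) ->
  eval_atoms env' (map (shift_atom f) s) = eval_atoms env s.
Proof.
move=> fP; rewrite /eval_atoms big_map; apply: eq_bigr => a _ /=.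
by rewrite -map_comp; congr A; apply: eq_map => j /=.
Qed.

Lemma mul_dyadicE c d : eval_dyadic (mul_dyadic c d) = eval_dyadic c * eval_dyadic d.
Proof.
by rewrite /eval_dyadic /= intrM exprD invfM; rewrite -!mulrA; congr *%R; rewrite mulrCA.
Qed.

Lemma add_dyadicE c d : eval_dyadic (add_dyadic c d) = eval_dyadic c + eval_dyadic d.
Proof.
have two0 j : (2 ^+ j : R) != 0 by rewrite expf_neq0 // pnatr_eq0.
have frac z j m : (j <= m)%N -> (z * 2 ^+ (m - j))%:~R / 2 ^+ m = z%:~R / 2 ^+ j :> R.
  move=> jm; rewrite intrM rmorphXn /= -{2}(subnK jm) exprD invfM mulrA mulfK //.
by rewrite /eval_dyadic /= intrD mulrDl !frac // ?leq_maxl ?leq_maxr.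
Qed.

Lemma mul_monomialE env m1 m2 :
  eval_monomial env (mul_monomial m1 m2) = eval_monomial env m1 * eval_monomial env m2.
Proof.
case: m1 => c1 [k1 s1]; case: m2 => c2 [k2 s2].
rewrite /eval_monomial mul_dyadicE [RHS]mulrACA; congr (_ * _).
rewrite /eval_body /= sumk_add mulrC -sumkZ; apply: eq_sumk => b1 s1E.
rewrite mulrC -sumkZ; apply: eq_sumk => b2 s2E.
rewrite {1}/eval_atoms big_cat /=; congr (_ * _); apply: eval_atoms_shift => j.
  by rewrite -catA nth_cat s2E ltnNge leq_addr /= addKn.
rewrite -catA [RHS]nth_cat s2E; case: ltnP => jk.
  by rewrite nth_cat s2E jk.
rewrite nth_cat s2E ltnNge (leq_trans jk (leq_addr _ _)) /=.
by rewrite nth_cat s1E ltnNge -addnBAC // leq_addl /= addnK.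
Qed.

Lemma normal_formE env e : interp env e = \sum_(m <- normal_form e) eval_monomial env m.
Proof.
have one d s : eval_monomial env (d, (0%N, s)) = eval_dyadic d * eval_atoms env s by [].
have atoms0 v : eval_atoms v [::] = 1 by rewrite /eval_atoms big_nil.
elim: e env one atoms0 => [s ix|k||e IH|e IHe f IHf|e IHe f IHf|e IH] env one atoms0 /=.
- rewrite big_seq1 one /eval_dyadic /eval_atoms expr0 divr1 mul1r big_seq1.
  by [].
- by rewrite big_seq1 one atoms0 mulr1 /eval_dyadic expr0 divr1.
- by rewrite big_seq1 one atoms0 mulr1 /eval_dyadic mul1r expr1.
- rewrite IH // big_map -sumrN; apply: eq_bigr => m _.
  by rewrite /eval_monomial /eval_dyadic /= intrN !mulNr.
- by rewrite IHe // IHf // big_cat.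
- rewrite IHe // IHf // big_distrlr /= big_allpairs_dep.
  by apply: eq_bigr => m1 _; apply: eq_bigr => m2 _; rewrite mul_monomialE.
- rewrite big_map; under eq_bigr do rewrite IH //.
  rewrite exchange_big /=; apply: eq_bigr => m _.
  rewrite -mulr_sumr; congr (_ * _); apply: eq_bigr => c _.
  by apply: eq_sumk => b _; rewrite cat_rcons.
Qed.

Lemma eval_atoms_sort env s : eval_atoms env (map sort_atom s) = eval_atoms env s.
Proof.
rewrite /eval_atoms big_map; apply: eq_bigr => a _; apply: A_sym.
by apply: perm_map; rewrite /= perm_sort.
Qed.

(** Equality of the values needs the symmetry of the tensors, since the indices of
    the factors are compared up to order. *)
Lemma alpha_equivE env m1 m2 : alpha_equiv m1 m2 -> eval_body env m1 = eval_body env m2.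
Proof.
case: m1 m2 => [k s1] [k2 s2] /= /and3P[/eqP <- _].
case: find_ren => [r|//] /andP[rP sP]; rewrite /eval_body /=.
rewrite -(sumk_perm _ rP); apply: eq_sumk => b sb.
have sr : size r = k by rewrite (perm_size rP) size_iota.
rewrite -[RHS]eval_atoms_sort.
have -> : eval_atoms (b ++ env) (map sort_atom s2) =
    eval_atoms (b ++ env) (map sort_atom (map (shift_atom (rename k r)) s1)).
  by apply/esym/perm_big.
rewrite eval_atoms_sort.
apply/esym/eval_atoms_shift => j; rewrite /rename nth_cat sb [RHS]nth_cat size_map sr.
case: (ltnP j k) => jk; last by rewrite ltnNge jk.
rewrite (nth_map 0%N) ?sr // ifT //.
have : nth 0%N r j \in r by rewrite mem_nth ?sr.
by rewrite (perm_mem rP) mem_iota.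
Qed.

Lemma collect_likeE env fuel l :
  \sum_(m <- collect_like fuel l) eval_monomial env m = \sum_(m <- l) eval_monomial env m.
Proof.
elim: fuel l => [//|fuel IH] [//|m l] /=.
set same := seq.filter _ l; set other := seq.filter _ l.
set c := foldr _ _ _.
have cE : eval_dyadic c * eval_body env m.2 = \sum_(x <- m :: same) eval_monomial env x.
  have : all (fun x => alpha_equiv x.2 m.2) same by apply: filter_all.
  rewrite /c; elim: (same) => [|x sm IHs]; first by rewrite big_seq1.
  rewrite [foldr _ _ _]/= => /andP[xm /IHs IHsm].
  rewrite add_dyadicE mulrDl IHsm !big_cons addrCA.
  by rewrite [eval_monomial env x]/eval_monomial (alpha_equivE env xm).
have -> : \sum_(x <- m :: l) eval_monomial env x =
          eval_dyadic c * eval_body env m.2 + \sum_(x <- other) eval_monomial env x.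
  rewrite cE !big_cons -addrA; congr (_ + _); rewrite !big_filter;
     exact: (bigID (fun x : monomial => alpha_equiv x.2 m.2)).
case: eqP => c0; last by rewrite big_cons IH.
by rewrite IH /eval_dyadic c0 !mul0r add0r.
Qed.

(** Collecting like monomials preserves the value of the difference of the two
    sides, and a successful run leaves no monomial. *)
Theorem tensor_identityP e1 e2 : tensor_identity e1 e2 ->
  forall env, interp env e1 = interp env e2.
Proof.
rewrite /tensor_identity; set l := normal_form _ => /nilP l0 env; apply/subr0_eq.
rewrite -/(interp env (Add e1 (Opp e2))) normal_formE -(collect_likeE env (size l)) l0.
by rewrite big_nil.
Qed.

End Semantics.

(** * Iterated partial derivatives and the components at a point *)

Section Calculus.
Variables (R : realType) (n : nat).
Local Notation point := 'rV[R]_n.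
Local Notation field := (point -> R).

Definition iter_partial (f : field) (ix : seq 'I_n) : field := foldr (@partial R n) f ix.

Lemma partial_ext (A : set point) (f g : field) i x : open A -> A x ->
  (forall y, A y -> f y = g y) -> partial i f x = partial i g x.
Proof.
move=> Ao Ax fg; apply: near_eq_derive.
have : nbhs x A by exact: open_nbhs_nbhs.
by apply: filterS => y /fg.
Qed.

Lemma Ck_on_cont k (A : set point) f : Ck_on k A f -> {in A, continuous f}.
Proof. by case: k => [|k] []. Qed.

Lemma Ck_on_iter k (A : set point) f ix : Ck_on k A f -> (size ix <= k)%N ->
  Ck_on (k - size ix) A (iter_partial f ix).
Proof.
move=> fC; elim: ix => [|i ix IH] /= ixk; first by rewrite subn0.
have := IH (ltnW ixk); rewrite -[(k - size ix)%N]prednK ?subn_gt0 // -subnS.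
by case=> _ /(_ i) [].
Qed.

Lemma Ck_on_C1 k (A : set point) f x : open A -> A x -> Ck_on k.+1 A f -> C1_near f x.
Proof.
move=> Ao Ax [_ fC] i; have [fd fc] := fC i; split.
  have : nbhs x A by exact: open_nbhs_nbhs.
  by apply: filterS => y Ay; apply: fd; rewrite inE.
by have := Ck_on_cont fc; apply; rewrite inE.
Qed.

Lemma iter_partial_C1 k (A : set point) f ix x : open A -> A x -> Ck_on k A f ->
  (size ix < k)%N -> C1_near (iter_partial f ix) x.
Proof.
move=> Ao Ax fC ixk; have := Ck_on_iter fC (ltnW ixk).
by rewrite -[(k - _)%N]prednK ?subn_gt0 //; exact: Ck_on_C1.
Qed.

(** Schwarz's theorem at the depth of [s]: the equality holds on the whole open
    set, so it can be differentiated along [s]. *)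
Lemma iter_partial_swap k (A : set point) f s i j t x : open A -> Ck_on k A f ->
  (size (s ++ i :: j :: t) <= k)%N -> A x ->
  iter_partial f (s ++ i :: j :: t) x = iter_partial f (s ++ j :: i :: t) x.
Proof.
move=> Ao fC; elim: s x => [|a s IH] x /= sk Ax.
  have tk : (size t < k)%N by apply: leq_trans sk; rewrite ltnS leqnSn.
  apply: Schwarz; first exact: (iter_partial_C1 _ _ fC).
    exact: (@iter_partial_C1 k A f (i :: t)).
  exact: (@iter_partial_C1 k A f (j :: t)).
by apply: (partial_ext _ Ao Ax) => y Ay; apply: IH => //; exact: ltnW.
Qed.

End Calculus.

Lemma continuous_scale (R : realType) (T : topologicalType) (f : T -> R) (c : R) (x : T) :
  {for x, continuous f} -> {for x, continuous (fun y => c * f y)}.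
Proof. by move=> fc; apply: cvgMl_tmp; exact: fc. Qed.

Section Ck_functions.
Variables (R : realType) (n : nat).
Local Notation point := 'rV[R]_n.
Implicit Types (f g : point -> R) (x : point).

Lemma Ck_on_le k (A : set point) f : Ck_on k.+1 A f -> Ck_on k A f.
Proof.
elim: k f => [|k IH] f; first by case.
by case=> fc fC; split=> // i; have [fd /IH] := fC i.
Qed.

Lemma Ck_on_ext k (A : set point) f g : open A -> (forall x, A x -> f x = g x) ->
  Ck_on k A f -> Ck_on k A g.
Proof.
move=> Ao; have nearA x : A x -> nbhs x A by move=> Ax; exact: open_nbhs_nbhs.
have cont f' g' : (forall x, A x -> f' x = g' x) -> {in A, continuous f'} ->
    {in A, continuous g'}.
  move=> fg fc x xA; have Ax : A x by rewrite inE in xA.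
  have fgx : \forall y \near x, f' y = g' y.
    by have := nearA x Ax; apply: filterS => y /fg.
  by rewrite /continuous_at -fg //; exact: cvg_trans (near_eq_cvg fgx) (fc x xA).
elim: k f g => [|k IH] f g fg.
  by move=> [fc _]; split => //; exact: cont fc.
move=> [fc fC]; split; first exact: cont fc.
move=> i; have [fd fC'] := fC i; split.
  move=> x xA; have Ax : A x by rewrite inE in xA.
  have fgx : \forall y \near x, f y = g y.
    by have := nearA x Ax; apply: filterS => y /fg.
  exact: near_eq_derivable fgx (fd x xA).
by apply: IH fC' => x Ax; exact: (partial_ext _ Ao Ax fg).
Qed.

Lemma partial_scale f (c : R) i x : derivable f x (delta_mx 0 i) ->
  partial i (fun y => c * f y) x = c * partial i f x.
Proof.
move=> fd; exact: (@derive_val _ _ _ _ _ _ _ (is_derive_scale c (derivableP fd))).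
Qed.

Lemma Ck_on_scale k (A : set point) f (c : R) : open A -> Ck_on k A f ->
  Ck_on k A (fun x => c * f x).
Proof.
move=> Ao; have cont f' : {in A, continuous f'} -> {in A, continuous (fun x => c * f' x)}.
  by move=> fc x xA; apply: continuous_scale; exact: fc.
elim: k f => [|k IH] f; first by move=> [fc _]; split=> //; exact: cont.
move=> [fc fC]; split; first exact: cont.
move=> i; have [fd fC'] := fC i; split.
  move=> x xA; apply: ex_derive; apply: is_derive_scale; apply: derivableP; exact: fd.
apply: (Ck_on_ext Ao _ (IH _ fC')) => x Ax.
by rewrite partial_scale //; apply: fd; rewrite inE.
Qed.

Lemma iter_partial_scale k (A : set point) f (c : R) ix x : open A -> Ck_on k A f ->
  (size ix <= k)%N -> A x ->
  iter_partial (fun y => c * f y) ix x = c * iter_partial f ix x.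
Proof.
move=> Ao fC; elim: ix x => [//|i ix IH] x /= ixk Ax.
rewrite (partial_ext i Ao Ax (fun y => IH y (ltnW ixk))) partial_scale //.
have [/nbhs_singleton + _] := iter_partial_C1 Ao Ax fC ixk i.
by [].
Qed.

Lemma partial_cst (c : R) i : partial i (fun _ : point => c) = fun=> 0.
Proof. by apply/funext => x; exact: derive_cst. Qed.

Lemma Ck_on_cst k (A : set point) (c : R) : Ck_on k A (fun=> c).
Proof.
have cc (d : R) : {in A, continuous (fun _ : point => d)} by move=> x _; exact: cst_continuous.
elim: k c => [|k IH] c; split=> //.
move=> i; split=> [x _|]; first by apply: ex_derive; exact: is_derive_const.
by rewrite (partial_cst c i); exact: IH.
Qed.

End Ck_functions.

(** Adjacent transpositions generate the symmetric group. *)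
Lemma perm_invariant (T : eqType) (S : Type) (F : seq T -> S) :
  (forall s i j t, F (s ++ i :: j :: t) = F (s ++ j :: i :: t)) ->
  forall s1 s2, perm_eq s1 s2 -> F s1 = F s2.
Proof.
move=> Fswap s1 s2 s12; suff H p : F (p ++ s1) = F (p ++ s2) by exact: (H [::]).
have move_in x u v q : F (q ++ x :: u ++ v) = F (q ++ u ++ x :: v).
  elim: u q => [//|y u IH] q; rewrite /= Fswap -cat_rcons IH.
  by rewrite cat_rcons.
elim: s1 s2 s12 p => [|x s1 IH] s2 s12 p.
  by move: s12; rewrite perm_sym => /perm_nilP ->.
have xs2 : x \in s2 by rewrite -(perm_mem s12) mem_head.
case/splitPr: xs2 s12 => u v s12.
rewrite -move_in -(cat_rcons _ p s1) -(cat_rcons _ p (u ++ v)).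
apply: IH; rewrite -(perm_cons x) (perm_trans s12) //.
exact: permEl (perm_catCA u [:: x] v).
Qed.

Section Contractions.
Variables (R : comPzRingType) (n : nat).

Lemma sum_swap (p q : 'I_n -> R) (F : 'I_n -> 'I_n -> R) :
  \sum_a p a * (\sum_b q b * F a b) = \sum_b q b * (\sum_a p a * F a b).
Proof.
under eq_bigr do rewrite mulr_sumr; rewrite exchange_big.
apply: eq_bigr => b _; rewrite mulr_sumr; apply: eq_bigr => a _.
by rewrite mulrCA.
Qed.

Lemma sum_swap_sym (p q : 'I_n -> R) (F : 'I_n -> 'I_n -> R) :
  (forall a b, F a b = F b a) ->
  \sum_a p a * (\sum_b q b * F a b) = \sum_a q a * (\sum_b p b * F a b).
Proof.
move=> Fsym; rewrite sum_swap; apply: eq_bigr => b _; congr (_ * _).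
by apply: eq_bigr => a _; rewrite Fsym.
Qed.

Lemma sum_addC (F G : 'I_n -> R) : \sum_a (F a + G a) = \sum_a G a + \sum_a F a.
Proof. by rewrite big_split addrC. Qed.

End Contractions.

Section Hessian_atoms.
Variables (R : realType) (n : nat) (Omega U : set 'rV[R]_n) (Phi W : 'rV[R]_n -> R).
Local Notation point := 'rV[R]_n.
Local Notation e_ i := (delta_mx 0 i : point).
Local Notation h := (hess Phi).
Hypothesis Omega_open : open Omega.
Hypothesis U_open : open U.
Hypothesis Phi_C5 : Ck_on 5 Omega Phi.
Hypothesis W_C3 : Ck_on 3 U W.
Hypothesis grad_U : forall x, Omega x -> U (grad Phi x).
Hypothesis h_unit : forall x, Omega x -> h x \in unitmx.

Definition W1l (i : 'I_n) : point -> R := lower h (W1u Phi W) i.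

(** Lowering the indices of the derivatives of [W] removes the metric with lower
    indices from all formulas, so that the contraction [Phi^ab Phi_bc] never has to
    be simplified.  The value 0 of malformed atoms makes the symmetry in the indices
    unconditional. *)
Definition atom_value (x : point) (s : symbol) (ix : seq 'I_n) : R :=
  match s with
  | Hinv => if ix is [:: a; b] then hinv h a b x else 0
  | DPhi => if (size ix <= 5)%N then iter_partial Phi ix x else 0
  | DW => match ix with
          | [:: i] => W1l i x
          | [:: i; j] => W2l Phi W i j x
          | [:: i; j; k] => W3l Phi W i j k x
          | _ => 0
          end
  end.

Lemma hess_sym x i j : Omega x -> h x i j = h x j i.
Proof.
by move=> Ox; rewrite !mxE; apply: (@iter_partial_swap R n 5 Omega Phi [::] i j [::]).
Qed.

Lemma hinv_sym x a b : Omega x -> hinv h a b x = hinv h b a x.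
Proof.
move=> Ox; have hT : (h x)^T = h x by apply/matrixP => i j; rewrite mxE hess_sym.
by rewrite /hinv -[in LHS]hT -trmx_inv mxE.
Qed.

Lemma atom_value_sym x s ix iy : Omega x -> perm_eq ix iy ->
  atom_value x s ix = atom_value x s iy.
Proof.
move=> Ox; move: ix iy; apply: perm_invariant => p i j t; case: s => /=.
- by case: p => [|a [|b [|c p]]] //=; case: t => [|c t] //=; exact: hinv_sym.
- rewrite !size_cat /=; case: ifP => // s5.
  by apply: (iter_partial_swap Omega_open Phi_C5) => //; rewrite size_cat.
have GU := grad_U Ox.
case: p => [|a [|b [|c [|d p]]]] //=; case: t => [|k [|l t]] //=.
- apply: (sum_swap_sym (h x i) (h x j) (F := fun a b => D2 W a b (grad Phi x))).
  by move=> a b; exact: (@iter_partial_swap R n 3 U W [::] a b [::]).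
- apply: (sum_swap_sym (h x i) (h x j)
    (F := fun a b => \sum_c h x k c * D3 W a b c (grad Phi x))) => a b.
  apply: eq_bigr => c _; apply: (congr1 ( *%R (h x k c))).
  exact: (@iter_partial_swap R n 3 U W [::] a b [:: c]).
rewrite /W3l /lower3 [LHS]/lower [RHS]/lower.
apply: eq_bigr => c _; apply: (congr1 ( *%R (h x a c))).
apply: (sum_swap_sym (h x i) (h x j) (F := fun b d => D3 W c b d (grad Phi x))) => b d.
exact: (@iter_partial_swap R n 3 U W [:: c] b d [::]).
Qed.

Lemma hinvK x i (F : 'I_n -> R) : Omega x ->
  \sum_a hinv h i a x * \sum_b h x a b * F b = F i.
Proof.
move=> Ox; pose v : 'cV_n := \col_b F b.
transitivity ((invmx (h x) *m (h x *m v)) i 0); last by rewrite mulKmx ?h_unit // mxE.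
rewrite mxE; apply: eq_bigr => a _; congr (_ * _); rewrite mxE.
by apply: eq_bigr => b _; rewrite [v _ _]mxE.
Qed.

Lemma hessK x i (F : 'I_n -> R) : Omega x ->
  \sum_a h x i a * \sum_b hinv h a b x * F b = F i.
Proof.
move=> Ox; pose v : 'cV_n := \col_b F b.
transitivity ((h x *m (invmx (h x) *m v)) i 0); last by rewrite mulKVmx ?h_unit // mxE.
rewrite mxE; apply: eq_bigr => a _; congr (_ * _); rewrite mxE.
by apply: eq_bigr => b _; rewrite [v _ _]mxE.
Qed.

Lemma is_derive_iter x p ix : Omega x -> (size ix < 5)%N ->
  is_derive x (e_ p) (iter_partial Phi ix) (iter_partial Phi (p :: ix) x).
Proof.
move=> Ox ix5; apply: derivableP.
have [/nbhs_singleton + _] := iter_partial_C1 Omega_open Ox Phi_C5 ix5 p.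
by [].
Qed.

Lemma is_derive_hess x p i j : Omega x ->
  is_derive x (e_ p) (fun y => h y i j) (D3 Phi p i j x).
Proof.
move=> Ox; rewrite (_ : (fun y => h y i j) = D2 Phi i j).
  exact: (@is_derive_iter x p [:: i; j]).
by apply/funext => y; rewrite mxE.
Qed.

Lemma is_derive_hinv x p a b : Omega x ->
  is_derive x (e_ p) (hinv h a b)
    (- \sum_c \sum_d hinv h a c x * (hinv h b d x * D3 Phi p c d x)).
Proof.
move=> Ox; have := @is_derive_invmx R _ n h (\matrix_(i, j) D3 Phi p i j x) Omega x (e_ p)
  Omega_open Ox h_unit.
move=> H; apply: is_derive_eq (H _ a b) _ => [i j|].
  by apply: is_derive_eq (is_derive_hess p i j Ox) _; rewrite mxE.
congr (- _); apply: eq_bigr => c _; apply: eq_bigr => d _; rewrite mxE.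
by rewrite -mulrA [_ * invmx _ _ _]mulrC (hinv_sym b d Ox).
Qed.

Lemma is_derive_grad_comp x p f : Omega x -> C1_near f (grad Phi x) ->
  is_derive x (e_ p) (fun y => f (grad Phi y))
    (\sum_b h x p b * partial b f (grad Phi x)).
Proof.
move=> Ox fC.
have E b : (fun z => grad Phi z 0 b) = partial b Phi by apply/funext => z; rewrite mxE.
have H := @is_derive_comp_C1 R n point (grad Phi) f x (e_ p) _ fC.
apply: is_derive_eq (H _) _ => [b|].
  by rewrite E; apply: ex_derive; exact: (@is_derive_iter x p [:: b]).
by apply: eq_bigr => b _; rewrite E mxE.
Qed.

End Hessian_atoms.

(** * Symbolic differentiation *)

Definition Phi3E i j k := Atom DPhi [:: i; j; k].
Definition HiE i j := Atom Hinv [:: i; j].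

(** The rules of the differential calculus of a Hessian metric; see
    [is_derive_hinv], [is_derive_W1] and [is_derive_W2].  The value in the default
    case is arbitrary, as [differentiable_expr] excludes it. *)
Definition d_atom p s ix : expr :=
  match s, ix with
  | Hinv, [:: a; b] => Opp (Sum (Sum (Mul (HiE a.+2 1) (Mul (HiE b.+2 0) (Phi3E p.+2 1 0)))))
  | DPhi, _ => Atom DPhi (p :: ix)
  | DW, [:: i] => Add (Atom DW [:: p; i])
       (Sum (Sum (Mul (Phi3E p.+2 i.+2 1) (Mul (HiE 1 0) (Atom DW [:: 0%N])))))
  | DW, [:: i; j] => Add (Atom DW [:: p; i; j])
      (Add (Sum (Sum (Mul (Phi3E p.+2 i.+2 1) (Mul (HiE 1 0) (Atom DW [:: 0%N; j.+2])))))
       (Sum (Sum (Mul (Phi3E p.+2 j.+2 1) (Mul (HiE 1 0) (Atom DW [:: 0%N; i.+2]))))))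
  | _, _ => Const 0
  end.

Fixpoint dexpr p e : expr :=
  match e with
  | Atom s ix => d_atom p s ix
  | Const _ | Half => Const 0
  | Opp e => Opp (dexpr p e)
  | Add e f => Add (dexpr p e) (dexpr p f)
  | Mul e f => Add (Mul (dexpr p e) f) (Mul e (dexpr p f))
  | Sum e => Sum (dexpr p.+1 e)
  end.

(** Bounds the orders so that a further derivative stays within the classes [C^5]
    of [Phi] and [C^3] of [W]. *)
Fixpoint differentiable_expr e : bool :=
  match e with
  | Atom Hinv ix => size ix == 2
  | Atom DPhi ix => (size ix < 5)%N
  | Atom DW ix => (size ix == 1%N) || (size ix == 2)
  | Const _ | Half => true
  | Opp e | Sum e => differentiable_expr e
  | Add e f | Mul e f => differentiable_expr e && differentiable_expr f
  end.

Section Symbolic_derivative.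
Variables (R : realType) (n : nat) (Omega U : set 'rV[R]_n) (Phi W : 'rV[R]_n -> R).
Local Notation point := 'rV[R]_n.
Local Notation e_ i := (delta_mx 0 i : point).
Local Notation h := (hess Phi).
Hypothesis Omega_open : open Omega.
Hypothesis U_open : open U.
Hypothesis Phi_C5 : Ck_on 5 Omega Phi.
Hypothesis W_C3 : Ck_on 3 U W.
Hypothesis grad_U : forall x, Omega x -> U (grad Phi x).
Hypothesis h_unit : forall x, Omega x -> h x \in unitmx.
Variable i0 : 'I_n.

Definition ev x env e := interp i0 (atom_value Phi W x) env e.

Let W_comp x p ix : Omega x -> (size ix < 3)%N ->
  is_derive x (e_ p) (fun y => iter_partial W ix (grad Phi y))
    (\sum_b h x p b * iter_partial W (b :: ix) (grad Phi x)).
Proof.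
move=> Ox ix3; apply: (is_derive_grad_comp Omega_open Phi_C5) => //.
exact: (iter_partial_C1 U_open (grad_U Ox) W_C3).
Qed.

Lemma is_derive_W1 x p i : Omega x ->
  is_derive x (e_ p) (W1l Phi W i)
    (W2l Phi W p i x + \sum_a \sum_b D3 Phi p i a x * (hinv h a b x * W1l Phi W b x)).
Proof.
move=> Ox; apply: is_derive_eq.
  apply: is_derive_bigsum => a; apply: is_derive_mul.
    exact: (is_derive_hess Omega_open Phi_C5).
  exact: (@W_comp x p [:: a]).
apply: (etrans (sum_addC _ _)); apply: (congr2 +%R).
  exact: (sum_swap (h x i) (h x p) (fun a b => D2 W b a (grad Phi x))).
apply: eq_bigr => a _; rewrite -mulr_sumr; apply: (congr1 ( *%R _)).
exact/esym/(hinvK h_unit).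
Qed.

Lemma is_derive_W2 x p i j : Omega x ->
  is_derive x (e_ p) (W2l Phi W i j)
    (W3l Phi W p i j x
     + (\sum_a \sum_b D3 Phi p i a x * (hinv h a b x * W2l Phi W b j x)
        + \sum_a \sum_b D3 Phi p j a x * (hinv h a b x * W2l Phi W b i x))).
Proof.
move=> Ox; have Wsym a b : D2 W a b (grad Phi x) = D2 W b a (grad Phi x).
  by apply: (@iter_partial_swap R n 3 U W [::] a b [::]) => //; exact: grad_U.
apply: is_derive_eq.
  apply: is_derive_bigsum => a; apply: is_derive_mul.
    exact: (is_derive_hess Omega_open Phi_C5).
  apply: is_derive_bigsum => b; apply: is_derive_mul.
    exact: (is_derive_hess Omega_open Phi_C5).
  exact: (@W_comp x p [:: a; b]).
apply: (etrans (sum_addC _ _)).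
have E1 : \sum_a h x i a * (\sum_b (D3 Phi p j b x * iter_partial W [:: a; b] (grad Phi x) +
      h x j b * (\sum_c h x p c * iter_partial W [:: c; a; b] (grad Phi x)))) =
    W3l Phi W p i j x + \sum_a D3 Phi p j a x * \sum_b h x i b * D2 W a b (grad Phi x).
  under eq_bigr do rewrite big_split mulrDr.
  apply: (etrans (sum_addC _ _)); apply: (congr2 +%R); last first.
    exact: (sum_swap_sym (h x i) (fun b => D3 Phi p j b x)
      (F := fun a b => D2 W a b (grad Phi x)) Wsym).
  transitivity (\sum_a h x i a * \sum_c h x p c * \sum_b h x j b * D3 W c a b (grad Phi x)).
    apply: eq_bigr => a _; apply: (congr1 ( *%R _)).
    exact: (sum_swap (h x j) (h x p) (fun b c => D3 W c a b (grad Phi x))).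
  exact: (sum_swap (h x i) (h x p)
    (fun a c => \sum_b h x j b * D3 W c a b (grad Phi x))).
apply: (etrans (congr1 (+%R^~ _) E1)); rewrite -addrA; apply: (congr2 +%R) => //.
rewrite addrC; apply: (congr2 +%R); apply: eq_bigr => a _;
  rewrite -mulr_sumr; apply: (congr1 ( *%R _)); exact/esym/(hinvK h_unit).
Qed.

(** Under [Sum] the direction [p] acquires one more enclosing summation, hence the
    successor in [dexpr] and an induction over all contexts [env]. *)
Theorem is_derive_ev x env p e : Omega x -> differentiable_expr e ->
  is_derive x (e_ (nth i0 env p)) (fun y => ev y env e) (ev x env (dexpr p e)).
Proof.
move=> Ox; rewrite /ev; elim: e env p => [s ix|k||e IH|e IHe f IHf|e IHe f IHf|e IH] env p /=.
- case: s => [ix2|ix5|ix12].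
  + case: ix ix2 => [|a [|b [|c ix]]] // _.
    exact: (is_derive_hinv Omega_open Phi_C5 h_unit).
  + rewrite /atom_value /= size_map ix5 (ltnW ix5).
    by apply: (is_derive_iter Omega_open Phi_C5) => //; rewrite size_map.
  case: ix ix12 => [|a [|b [|c ix]]] // _; first exact: is_derive_W1.
  exact: is_derive_W2.
- by move=> _; exact: is_derive_const.
- by move=> _; exact: is_derive_const.
- by move=> /IH ?; exact: is_derive_opp.
- by move=> /andP[/IHe ? /IHf ?]; exact: is_derive_add.
- by move=> /andP[/IHe ? /IHf ?]; exact: is_derive_mul.
- by move=> ed; apply: is_derive_bigsum => c; exact: (IH (c :: env) p.+1 ed).
Qed.

Lemma partial_ev x env p e (f : point -> R) : Omega x -> differentiable_expr e ->
  (forall y, Omega y -> f y = ev y env e) ->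
  partial (nth i0 env p) f x = ev x env (dexpr p e).
Proof.
move=> Ox ed fe; rewrite (partial_ext _ Omega_open Ox fe).
exact: (@derive_val _ _ _ _ _ _ _ (is_derive_ev env p Ox ed)).
Qed.

Lemma ev_identity x env e1 e2 : Omega x -> tensor_identity e1 e2 ->
  ev x env e1 = ev x env e2.
Proof.
move=> Ox /tensor_identityP; apply => s ix iy.
exact: (atom_value_sym Omega_open U_open Phi_C5 W_C3 grad_U).
Qed.

End Symbolic_derivative.

(** * The tensors of a Hessian metric as expressions *)

Declare Scope expr_scope.
Delimit Scope expr_scope with expr.
Notation "a + b" := (Add a b) : expr_scope.
Notation "a - b" := (Add a (Opp b)) : expr_scope.
Notation "- a" := (Opp a) : expr_scope.
Notation "a * b" := (Mul a b) : expr_scope.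
Bind Scope expr_scope with expr.

(** In the definitions below an index that is used under [m] summations is shifted
    by [m], since [0], ..., [m - 1] name the indices of these summations, innermost
    first. *)
Definition gE i j := Sum (Sum (Phi3E i.+2 1 0 *
  Sum (HiE 2 0 * Sum (HiE 2 0 * Phi3E j.+4 1 0))))%expr.
Definition Phi3_uuE j a b := Sum (HiE a.+1 0 * Sum (HiE b.+2 0 * Phi3E j.+2 1 0))%expr.
Definition Phi3_uE m i b := Sum (HiE m.+1 0 * Phi3E 0 i.+1 b.+1)%expr.
Definition christoffelE k i j := (Half * Sum (HiE k.+1 0 * Phi3E 0 i.+1 j.+1))%expr.
Definition cov1E (w : nat -> expr) p i :=
  (dexpr p (w i) - Sum (christoffelE 0 p.+1 i.+1 * w 0%N))%expr.
Definition cov2E (T : nat -> nat -> expr) p i j :=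
  (dexpr p (T i j) - Sum (christoffelE 0 p.+1 i.+1 * T 0%N j.+1)
                   - Sum (christoffelE 0 p.+1 j.+1 * T i.+1 0%N))%expr.
Definition cov3E (T : nat -> nat -> nat -> expr) p i j k :=
  (dexpr p (T i j k) - Sum (christoffelE 0 p.+1 i.+1 * T 0%N j.+1 k.+1)
                     - Sum (christoffelE 0 p.+1 j.+1 * T i.+1 0%N k.+1)
                     - Sum (christoffelE 0 p.+1 k.+1 * T i.+1 j.+1 0%N))%expr.
Definition W1E i := Atom DW [:: i].
Definition W2E i j := Atom DW [:: i; j].
Definition W3E i j k := Atom DW [:: i; j; k].

(** This form of the first derivatives of [V] is where the equation enters: see
    [partial_V]. *)
Definition V1E i := (W1E i - Sum (Sum (HiE 1 0 * Phi3E i.+2 1 0)))%expr.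
Definition V2E i j := dexpr i (V1E j).
Definition V3E i j k := dexpr i (V2E j k).
Definition raiseE (w : nat -> expr) i := Sum (HiE i.+1 0 * w 0%N)%expr.
Definition mixedE (T : nat -> nat -> expr) k j := Sum (HiE k.+1 0 * T 0%N j.+1)%expr.
Definition wlaplacianE i j :=
  (Sum (Sum (HiE 1 0 * cov3E (cov2E gE) 1 0 i.+2 j.+2))
   - Half * Sum ((raiseE V1E 0 + raiseE W1E 0) * cov2E gE 0 i.+1 j.+1))%expr.
Definition nabla_sqE i j := Sum (Sum (Sum (cov3E Phi3E 2 i.+3 1 0 *
  Sum (HiE 3 0 * Sum (HiE 3 0 * Sum (HiE 3 0 * cov3E Phi3E 2 j.+4.+2 1 0))))))%expr.
Definition riemannE i k j l := (Half * Half *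
  (Sum (Phi3E i.+1 l.+1 0 * Phi3_uE 0 k.+1 j.+1)
   - Sum (Phi3E i.+1 j.+1 0 * Phi3_uE 0 k.+1 l.+1)))%expr.
Definition riem_sqE i j := Sum (Sum (Sum (riemannE i.+3 2 1 0 *
  Sum (HiE 3 0 * Sum (HiE 3 0 * Sum (HiE 3 0 * riemannE j.+4.+2 2 1 0))))))%expr.
Definition ric_muE i j :=
  (Sum (Sum (HiE 1 0 * riemannE i.+2 1 j.+2 0))
   + cov1E (fun i => Half * (V1E i + W1E i)) i j)%expr.
Definition VWE i j := (V2E i j + W2E i j)%expr.
Definition rhsE i j :=
  (Sum (Sum ((- V3E i.+2 1 0 + W3E i.+2 1 0) * Phi3_uuE j.+2 1 0))
 + Sum (Sum ((- V3E j.+2 1 0 + W3E j.+2 1 0) * Phi3_uuE i.+2 1 0))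
 + Half * (Sum (VWE i.+1 0 * mixedE gE 0 j.+1) + Sum (VWE j.+1 0 * mixedE gE 0 i.+1))
 + Const 2 * Sum (Sum (Sum (VWE 2 1 * Phi3_uE 1 i.+3 0 * Phi3_uuE j.+3 2 0)))
 + Half * Sum (gE 0 i.+1 * mixedE gE 0 j.+1)
 + Const 2 * nabla_sqE i j + Const 8 * riem_sqE i j)%expr.

(** The core of the first identity: after the elimination of [V] it is formal. *)
Lemma wlaplacian_identity : tensor_identity (wlaplacianE 0 1) (rhsE 0 1).
Proof. by vm_compute. Qed.

Lemma ric_mu_identity : tensor_identity (ric_muE 0 1)
  (Half * Half * gE 0 1 + Half * V2E 0 1 + Half * W2E 0 1)%expr.
Proof. by vm_compute. Qed.

(** In the names of the indices, [0] is the upper index of the Christoffel symbols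
    and [1], [2], [3] are the arguments [i], [k], [l] of the curvature. *)
Lemma riemann_identity : tensor_identity
  (dexpr 1 (christoffelE 0 2 3) - dexpr 2 (christoffelE 0 1 3)
   + Sum (christoffelE 1 2 0 * christoffelE 0 3 4
          - christoffelE 1 3 0 * christoffelE 0 2 4))%expr
  (Sum (HiE 1 0 * riemannE 2 3 0 4)%expr).
Proof. by vm_compute. Qed.

Section Translation.
Variables (R : realType) (n : nat) (Omega U : set 'rV[R]_n) (Phi V W : 'rV[R]_n -> R).
Local Notation point := 'rV[R]_n.
Local Notation e_ i := (delta_mx 0 i : point).
Local Notation h := (hess Phi).
Hypothesis Omega_open : open Omega.
Hypothesis U_open : open U.
Hypothesis Phi_C5 : Ck_on 5 Omega Phi.
Hypothesis V_C3 : Ck_on 3 Omega V.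
Hypothesis W_C3 : Ck_on 3 U W.
Hypothesis grad_U : forall x, Omega x -> U (grad Phi x).
Hypothesis MA : forall x, Omega x ->
  expR (- V x) = expR (- W (grad Phi x)) * \det (h x).
Variable i0 : 'I_n.

Lemma Monge_Ampere_unit x : Omega x -> h x \in unitmx.
Proof.
move=> Ox; rewrite unitmxE unitfE; apply/eqP => d0; have := MA Ox.
by rewrite d0 mulr0 => /eqP; rewrite gt_eqF // expR_gt0.
Qed.
Let h_unit := Monge_Ampere_unit.

Local Notation ev := (ev Phi W i0).
Local Notation nth := (nth i0).

Lemma D3_perm x i j k i' j' k' : Omega x -> perm_eq [:: i; j; k] [:: i'; j'; k'] ->
  D3 Phi i j k x = D3 Phi i' j' k' x.
Proof.
move=> Ox; exact: (@atom_value_sym R n Omega U Phi W Omega_open U_open Phi_C5 W_C3 grad_U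
  x DPhi [:: i; j; k] [:: i'; j'; k'] Ox).
Qed.

(** The logarithmic derivative of the equation, by Jacobi's formula. *)
Lemma partial_V x i : Omega x -> partial i V x =
  W1l Phi W i x - \sum_a \sum_b hinv h a b x * D3 Phi i a b x.
Proof.
move=> Ox; have Vd : is_derive x (e_ i) V (partial i V x).
  by have [_ /(_ i)[Vd _]] := V_C3; apply: derivableP; apply: Vd; rewrite inE.
have Wd : is_derive x (e_ i) (fun y => W (grad Phi y)) (W1l Phi W i x).
  exact: (@is_derive_grad_comp R n Omega Phi Omega_open Phi_C5 x i W Ox
    (Ck_on_C1 U_open (grad_U Ox) W_C3)).
have hd := is_derive_det_unit (h_unit Ox) (dA := \matrix_(j, k) D3 Phi i j k x) (v := e_ i).
have {}hd : is_derive x (e_ i) (fun y => \det (h y))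
    (\det (h x) * \sum_a \sum_b hinv h a b x * D3 Phi i a b x).
  apply: is_derive_eq (hd _) _ => [j k|].
    by apply: is_derive_eq (is_derive_hess Omega_open Phi_C5 i j k Ox) _; rewrite mxE.
  apply: (congr1 ( *%R _)); apply: eq_bigr => a _; apply: eq_bigr => b _.
  rewrite mxE; apply: (congr1 ( *%R _)); apply: D3_perm => //.
  by rewrite /= perm_cons (permEl (perm_catC [:: b] [:: a])).
have L := is_derive_expR_comp (is_derive_opp Vd).
have Rd := is_derive_mul (is_derive_expR_comp (is_derive_opp Wd)) hd.
have := is_derive_ext_near Omega_open Ox MA Rd => /(@derive_val _ _ _ _ _ _ _).
rewrite (@derive_val _ _ _ _ _ _ _ L) (MA Ox).
have E0 : expR (- W (grad Phi x)) * \det (h x) != 0 by rewrite -MA // gt_eqF ?expR_gt0.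
move=> VE; apply: oppr_inj; apply: (mulfI E0); rewrite VE; ring.
Qed.

Lemma D1V_ev x env i : Omega x -> partial (nth env i) V x = ev x env (V1E i).
Proof. exact: partial_V. Qed.

Lemma D2V_ev x env i j : Omega x -> D2 V (nth env i) (nth env j) x = ev x env (V2E i j).
Proof.
move=> Ox; apply: (partial_ev Omega_open U_open Phi_C5 W_C3 grad_U h_unit) => // y Oy.
exact: D1V_ev.
Qed.

Lemma D3V_ev x env i j k : Omega x ->
  D3 V (nth env i) (nth env j) (nth env k) x = ev x env (V3E i j k).
Proof.
move=> Ox; apply: (partial_ev Omega_open U_open Phi_C5 W_C3 grad_U h_unit) => // y Oy.
exact: D2V_ev.
Qed.

Lemma W1u_ev x env i : Omega x -> W1u Phi W (nth env i) x = ev x env (raiseE W1E i).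
Proof. by move=> Ox; apply/esym/(hinvK h_unit). Qed.

(** The three terms of a Christoffel symbol are equal up to sign, because
    [Phi_ijk] is symmetric. *)
Lemma christoffel_hess x k i j : Omega x ->
  christoffel h k i j x = 2^-1 * \sum_a hinv h k a x * D3 Phi a i j x.
Proof.
move=> Ox; have dh p a b : partial p (fun y => h y a b) x = D3 Phi p a b x.
  exact: (@derive_val _ _ _ _ _ _ _ (is_derive_hess Omega_open Phi_C5 p a b Ox)).
rewrite mulr_sumr; apply: eq_bigr => a _; rewrite !dh mulrCA.
rewrite (D3_perm (i := j) (j := i) (k := a) (i' := i) (j' := j) (k' := a)) //; last first.
  by apply: permEl; exact: (perm_catCA [:: j] [:: i] [:: a]).
rewrite (D3_perm (i := i) (j := j) (k := a) (i' := a) (j' := i) (k' := j)) //; last first.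
  by apply: permEl; exact: (perm_catC [:: i; j] [:: a]).
by rewrite addrK.
Qed.

(** A covariant derivative evaluates its argument at summed indices and at points
    near the given one; hence a representation is required for all names of the
    indices and on the whole open set. *)
Definition represents1 (w : 'I_n -> point -> R) (wE : nat -> expr) := forall i,
  differentiable_expr (wE i) /\
  forall x env, Omega x -> w (nth env i) x = ev x env (wE i).

Definition represents2 (T : 'I_n -> 'I_n -> point -> R) (TE : nat -> nat -> expr) :=
  forall i j, differentiable_expr (TE i j) /\
  forall x env, Omega x -> T (nth env i) (nth env j) x = ev x env (TE i j).

Definition represents3 (T : 'I_n -> 'I_n -> 'I_n -> point -> R)
    (TE : nat -> nat -> nat -> expr) :=
  forall i j k, differentiable_expr (TE i j k) /\
  forall x env, Omega x -> T (nth env i) (nth env j) (nth env k) x = ev x env (TE i j k).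

Lemma cov1_ev w wE : represents1 w wE -> forall x env p i, Omega x ->
  cov1 h w (nth env p) (nth env i) x = ev x env (cov1E wE p i).
Proof.
move=> wP x env p i Ox; have [dw ew] := wP i.
apply: (congr2 +%R).
  apply: (partial_ev Omega_open U_open Phi_C5 W_C3 grad_U h_unit) => // y Oy.
  exact: ew.
apply: (congr1 -%R); apply: eq_bigr => a _; apply: (congr2 *%R).
  exact: christoffel_hess.
exact: ((wP 0%N).2 x (a :: env) Ox).
Qed.

Lemma cov2_ev T TE : represents2 T TE -> forall x env p i j, Omega x ->
  cov2 h T (nth env p) (nth env i) (nth env j) x = ev x env (cov2E TE p i j).
Proof.
move=> TP x env p i j Ox; have [dT eT] := TP i j.
apply: (congr2 +%R); first apply: (congr2 +%R).
- apply: (partial_ev Omega_open U_open Phi_C5 W_C3 grad_U h_unit) => // y Oy.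
  exact: eT.
- apply: (congr1 -%R); apply: eq_bigr => a _; apply: (congr2 *%R).
    exact: christoffel_hess.
  exact: ((TP 0%N j.+1).2 x (a :: env) Ox).
apply: (congr1 -%R); apply: eq_bigr => a _; apply: (congr2 *%R).
  exact: christoffel_hess.
exact: ((TP i.+1 0%N).2 x (a :: env) Ox).
Qed.

Lemma cov3_ev T TE : represents3 T TE -> forall x env p i j k, Omega x ->
  cov3 h T (nth env p) (nth env i) (nth env j) (nth env k) x = ev x env (cov3E TE p i j k).
Proof.
move=> TP x env p i j k Ox; have [dT eT] := TP i j k.
apply: (congr2 +%R); first apply: (congr2 +%R); first apply: (congr2 +%R).
- apply: (partial_ev Omega_open U_open Phi_C5 W_C3 grad_U h_unit) => // y Oy.
  exact: eT.
- apply: (congr1 -%R); apply: eq_bigr => a _; apply: (congr2 *%R).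
    exact: christoffel_hess.
  exact: ((TP 0%N j.+1 k.+1).2 x (a :: env) Ox).
- apply: (congr1 -%R); apply: eq_bigr => a _; apply: (congr2 *%R).
    exact: christoffel_hess.
  exact: ((TP i.+1 0%N k.+1).2 x (a :: env) Ox).
apply: (congr1 -%R); apply: eq_bigr => a _; apply: (congr2 *%R).
  exact: christoffel_hess.
exact: ((TP i.+1 j.+1 0%N).2 x (a :: env) Ox).
Qed.

Lemma gtensor_ev : represents2 (gtensor Phi) gE.
Proof. by []. Qed.

Lemma D3_ev : represents3 (D3 Phi) Phi3E.
Proof. by []. Qed.

Lemma wlaplacian_ev x env i j : Omega x ->
  wlaplacian Phi V W (gtensor Phi) (nth env i) (nth env j) x =
  ev x env (wlaplacianE i j).
Proof.
move=> Ox; have cov2g : represents3 (cov2 h (gtensor Phi)) (cov2E gE).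
  by move=> p k l; split=> // y env' Oy; exact: (cov2_ev gtensor_ev).
apply: (congr2 +%R).
  apply: eq_bigr => p _; apply: eq_bigr => q _; apply: (congr1 ( *%R _)).
  exact: (cov3_ev cov2g [:: q, p & env] 1 0 i.+2 j.+2 Ox).
apply: (congr1 -%R); apply: (congr1 ( *%R _)); apply: eq_bigr => k _.
apply: (congr2 *%R); last exact: ((cov2g 0%N i.+1 j.+1).2 x (k :: env) Ox).
apply: (congr2 +%R); last exact: (W1u_ev (k :: env) 0 Ox).
apply: eq_bigr => a _; apply: (congr1 ( *%R _)).
exact: (D1V_ev [:: a, k & env] 0 Ox).
Qed.

Lemma nabla_sq_ev x env i j : Omega x ->
  nabla_sq Phi (nth env i) (nth env j) x = ev x env (nabla_sqE i j).
Proof.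
move=> Ox; apply: eq_bigr => p _; apply: eq_bigr => a _; apply: eq_bigr => b _.
apply: (congr2 *%R); first exact: (cov3_ev D3_ev [:: b, a, p & env] 2 i.+3 1 0 Ox).
apply: eq_bigr => q _; apply: (congr1 ( *%R _)).
apply: eq_bigr => c _; apply: (congr1 ( *%R _)).
apply: eq_bigr => d _; apply: (congr1 ( *%R _)).
exact: (cov3_ev D3_ev [:: d, c, q, b, a, p & env] 2 j.+4.+2 1 0 Ox).
Qed.

(** By [riemann_identity] the curvature with its third index raised is the claimed
    tensor contracted with the inverse metric; lowering the index removes the
    latter. *)
Lemma riemann_ev x env i k j l : Omega x ->
  riemann h (nth env i) (nth env k) (nth env j) (nth env l) x =
  ev x env (riemannE i k j l).
Proof.
move=> Ox; set I := nth env i; set K := nth env k; set J := nth env j; set L := nth env l.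
pose Y q := ev x [:: q; I; K; L] (riemannE 1 2 0 3).
transitivity (Y J) => //; rewrite -[RHS](hessK h_unit J Y Ox).
apply: eq_bigr => m _; apply: (congr1 ( *%R _)).
have dGamma p a b : partial (nth [:: m; I; K; L] p)
      (christoffel h m (nth [:: m; I; K; L] a) (nth [:: m; I; K; L] b)) x =
    ev x [:: m; I; K; L] (dexpr p (christoffelE 0 a b)).
  apply: (partial_ev Omega_open U_open Phi_C5 W_C3 grad_U h_unit) => // y Oy.
  exact: christoffel_hess.
transitivity (ev x [:: m; I; K; L] (Sum (HiE 1 0 * riemannE 2 3 0 4)%expr)) => //.
rewrite -(ev_identity Omega_open U_open Phi_C5 W_C3 grad_U i0 _ Ox riemann_identity).
apply: (congr2 +%R).
  apply: (congr2 +%R); first exact: (dGamma 1 2 3)%N.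
  by apply: (congr1 -%R); exact: (dGamma 2 1 3)%N.
apply: eq_bigr => a _; apply: (congr2 +%R); [|apply: (congr1 -%R)];
  by apply: (congr2 *%R); exact: christoffel_hess.
Qed.

Lemma riem_sq_ev x env i j : Omega x ->
  riem_sq Phi (nth env i) (nth env j) x = ev x env (riem_sqE i j).
Proof.
move=> Ox; apply: eq_bigr => a _; apply: eq_bigr => b _; apply: eq_bigr => c _.
apply: (congr2 *%R); first exact: (riemann_ev [:: c, b, a & env] i.+3 2 1 0 Ox).
apply: eq_bigr => p _; apply: (congr1 ( *%R _)).
apply: eq_bigr => q _; apply: (congr1 ( *%R _)).
apply: eq_bigr => r _; apply: (congr1 ( *%R _)).
exact: (riemann_ev [:: r, q, p, c, b, a & env] j.+4.+2 2 1 0 Ox).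
Qed.

Lemma ric_mu_ev x env i j : Omega x ->
  ric_mu Phi V W (nth env i) (nth env j) x = ev x env (ric_muE i j).
Proof.
move=> Ox; apply: (congr2 +%R).
  apply: eq_bigr => k _; apply: eq_bigr => l _; apply: (congr1 ( *%R _)).
  exact: (riemann_ev [:: l, k & env] i.+2 1 j.+2 0 Ox).
apply: (cov1_ev (wE := fun i => (Half * (V1E i + W1E i))%expr)) => // k; split=> // y env' Oy.
have Vd : is_derive y (e_ (nth env' k)) V (partial (nth env' k) V y).
  by have [_ /(_ (nth env' k))[Vd _]] := V_C3; apply: derivableP; apply: Vd; rewrite inE.
have Wd : is_derive y (e_ (nth env' k)) (fun y => W (grad Phi y)) (W1l Phi W (nth env' k) y).
  exact: (@is_derive_grad_comp R n Omega Phi Omega_open Phi_C5 y _ W Oy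
    (Ck_on_C1 U_open (grad_U Oy) W_C3)).
rewrite /partial (@derive_val _ _ _ _ _ _ _ (is_derive_scale 2^-1 (is_derive_add Vd Wd))).
by apply: (congr1 ( *%R _)); apply: (congr2 +%R) => //; exact: D1V_ev.
Qed.

Lemma wlaplacian_gtensor x i j : Omega x ->
  wlaplacian Phi V W (gtensor Phi) i j x =
         \sum_a \sum_b (- D3 V i a b x + W3l Phi W i a b x) * Phi3_uu Phi j a b x
       + \sum_a \sum_b (- D3 V j a b x + W3l Phi W j a b x) * Phi3_uu Phi i a b x
       + 2^-1 * (\sum_s (D2 V i s x + W2l Phi W i s x)
                        * mixed (hess Phi) (gtensor Phi) s j x
               + \sum_s (D2 V j s x + W2l Phi W j s x)
                        * mixed (hess Phi) (gtensor Phi) s i x)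
       + 2 * \sum_a \sum_m \sum_b (D2 V a m x + W2l Phi W a m x)
                                  * Phi3_u Phi m i b x * Phi3_uu Phi j a b x
       + 2^-1 * \sum_k gtensor Phi k i x * mixed (hess Phi) (gtensor Phi) k j x
       + 2 * nabla_sq Phi i j x
       + 8 * riem_sq Phi i j x.
Proof.
move=> Ox; rewrite (wlaplacian_ev [:: i; j] 0 1 Ox).
rewrite (ev_identity Omega_open U_open Phi_C5 W_C3 grad_U i0 _ Ox wlaplacian_identity).
apply/esym; apply: (congr2 +%R); last first.
  by apply: (congr1 ( *%R _)); exact: (riem_sq_ev [:: i; j] 0 1 Ox).
apply: (congr2 +%R); last first.
  by apply: (congr1 ( *%R _)); exact: (nabla_sq_ev [:: i; j] 0 1 Ox).
apply: (congr2 +%R) => //.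
apply: (congr2 +%R); last first.
  apply: (congr1 ( *%R _)); apply: eq_bigr => a _; apply: eq_bigr => m _.
  apply: eq_bigr => b _.
  apply: (congr2 *%R) => //; apply: (congr2 *%R) => //; apply: (congr2 +%R) => //.
  exact: (D2V_ev [:: b; m; a; i; j] 2 1 Ox).
apply: (congr2 +%R); last first.
  apply: (congr1 ( *%R _)); apply: (congr2 +%R); apply: eq_bigr => s _;
    apply: (congr2 *%R) => //; apply: (congr2 +%R) => //.
    exact: (D2V_ev [:: s; i; j] 1 0 Ox).
  exact: (D2V_ev [:: s; i; j] 2 0 Ox).
apply: (congr2 +%R); apply: eq_bigr => a _; apply: eq_bigr => b _;
  apply: (congr2 *%R) => //; apply: (congr2 +%R) => //; apply: (congr1 -%R).
  exact: (D3V_ev [:: b; a; i; j] 2 1 0 Ox).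
exact: (D3V_ev [:: b; a; i; j] 3 1 0 Ox).
Qed.

Lemma ric_mu_gtensor x i j : Omega x ->
  ric_mu Phi V W i j x =
  2^-1 * 2^-1 * gtensor Phi i j x + 2^-1 * D2 V i j x + 2^-1 * W2l Phi W i j x.
Proof.
move=> Ox; rewrite (ric_mu_ev [:: i; j] 0 1 Ox).
rewrite (ev_identity Omega_open U_open Phi_C5 W_C3 grad_U i0 _ Ox ric_mu_identity).
apply: (congr2 +%R) => //; apply: (congr2 +%R) => //; apply: (congr1 ( *%R _)).
exact/esym/(D2V_ev [:: i; j] 0 1 Ox).
Qed.

End Translation.

(** * Squared norms of tensors of type (0,3) are nonnegative *)

Section Positivity.
Variables (R : realType) (n : nat).

(** If [H = A^T A], then [H] tensored three times with itself is the Gram matrix of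
    the threefold tensor power of [A]. *)
Lemma contraction_ge0 (H : 'M[R]_n) (Z : 'I_n -> 'I_n -> 'I_n -> R) : H^T = H -> psd H ->
  0 <= \sum_p \sum_a \sum_b Z p a b *
    \sum_q H p q * \sum_c H a c * \sum_d H b d * Z q c d.
Proof.
move=> HT /(psd_factor HT)[A HE].
have HA i j : H i j = \sum_k A k i * A k j.
  by rewrite HE mxE; apply: eq_bigr => k _; rewrite mxE.
pose I3 := ('I_n * ('I_n * 'I_n))%type.
have sum3 (F : 'I_n -> 'I_n -> 'I_n -> R) :
    \sum_p \sum_a \sum_b F p a b = \sum_(P : I3) F P.1 P.2.1 P.2.2.
  rewrite -(pair_bigA _ (fun p Q => F p Q.1 Q.2)) /=.
  by apply: eq_bigr => p _; rewrite pair_bigA.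
pose A3 (K P : I3) := A K.1 P.1 * (A K.2.1 P.2.1 * A K.2.2 P.2.2).
have H3 (P Q : I3) : H P.1 Q.1 * (H P.2.1 Q.2.1 * H P.2.2 Q.2.2) = \sum_K A3 K P * A3 K Q.
  rewrite -(sum3 (fun k l m =>
    A k P.1 * (A l P.2.1 * A m P.2.2) * (A k Q.1 * (A l Q.2.1 * A m Q.2.2)))).
  rewrite !HA mulr_suml; apply: eq_bigr => k _; rewrite mulr_suml mulr_sumr.
  apply: eq_bigr => l _; rewrite !mulr_sumr; apply: eq_bigr => m _; ring.
suff -> : \sum_p \sum_a \sum_b Z p a b *
    (\sum_q H p q * \sum_c H a c * \sum_d H b d * Z q c d) =
    \sum_K (\sum_(P : I3) A3 K P * Z P.1 P.2.1 P.2.2) ^+ 2.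
  by apply: sumr_ge0 => K _; exact: sqr_ge0.
under [RHS]eq_bigr do rewrite expr2 big_distrlr /=.
rewrite [RHS]exchange_big /= sum3; apply: eq_bigr => P _; rewrite [RHS]exchange_big /=.
transitivity (\sum_(Q : I3) Z P.1 P.2.1 P.2.2 *
   (H P.1 Q.1 * (H P.2.1 Q.2.1 * H P.2.2 Q.2.2) * Z Q.1 Q.2.1 Q.2.2)).
  rewrite -mulr_sumr -(sum3 (fun q c d => H P.1 q * (H P.2.1 c * H P.2.2 d) * Z q c d)).
  congr (_ * _); apply: eq_bigr => q _; rewrite mulr_sumr; apply: eq_bigr => c _.
  by rewrite !mulr_sumr; apply: eq_bigr => d _; ring.
apply: eq_bigr => Q _; rewrite H3 mulr_suml mulr_sumr; apply: eq_bigr => K _; ring.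
Qed.

(** By bilinearity the form is the squared norm of the single tensor
    [v^i S_i]. *)
Lemma gram_ge0 (h : 'rV[R]_n -> 'M[R]_n) (S : 'I_n -> 'I_n -> 'I_n -> 'I_n -> 'rV[R]_n -> R)
    (x : 'rV[R]_n) (v : 'I_n -> R) : (invmx (h x))^T = invmx (h x) -> psd (invmx (h x)) ->
  0 <= \sum_i \sum_j
    (\sum_p \sum_a \sum_b S i p a b x * raise3 h (S j) p a b x) * v i * v j.
Proof.
move=> HT Hpsd; set H := invmx (h x) in HT Hpsd.
pose Z p a b := \sum_i v i * S i p a b x.
suff -> : \sum_i \sum_j
    (\sum_p \sum_a \sum_b S i p a b x * raise3 h (S j) p a b x) * v i * v j =
    \sum_p \sum_a \sum_b Z p a b *
      \sum_q H p q * \sum_c H a c * \sum_d H b d * Z q c d.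
  exact: contraction_ge0.
have ZE p a b : \sum_q H p q * (\sum_c H a c * (\sum_d H b d * Z q c d)) =
    \sum_j v j * raise3 h (S j) p a b x.
  have pull (c : 'I_n -> R) (F : 'I_n -> 'I_n -> R) :
      \sum_q c q * (\sum_j v j * F j q) = \sum_j v j * \sum_q c q * F j q.
    by rewrite sum_swap.
  transitivity (\sum_q H p q * (\sum_c H a c * (\sum_j v j * \sum_d H b d * S j q c d x))).
    by apply: eq_bigr => q _; congr (_ * _); apply: eq_bigr => c _; rewrite -pull.
  transitivity (\sum_q H p q * (\sum_j v j * \sum_c H a c * \sum_d H b d * S j q c d x)).
    by apply: eq_bigr => q _; rewrite -pull.
  by rewrite pull.
under [RHS]eq_bigr => p _ do under eq_bigr => a _ do under eq_bigr => b _ do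
  rewrite ZE /Z big_distrlr /=.
transitivity (\sum_i \sum_j \sum_p \sum_a \sum_b
    v i * S i p a b x * (v j * raise3 h (S j) p a b x)).
  apply: eq_bigr => i _; apply: eq_bigr => j _; rewrite !mulr_suml; apply: eq_bigr => p _.
  rewrite !mulr_suml; apply: eq_bigr => a _; rewrite !mulr_suml; apply: eq_bigr => b _; ring.
pose G i j p a b := v i * S i p a b x * (v j * raise3 h (S j) p a b x).
have ex (F : 'I_n -> 'I_n -> 'I_n -> R) :
    \sum_i \sum_j \sum_p F i j p = \sum_p \sum_i \sum_j F i j p.
  by under eq_bigr do rewrite exchange_big; rewrite exchange_big.
rewrite (ex (fun i j p => \sum_a \sum_b G i j p a b)); apply: eq_bigr => p _.
rewrite (ex (fun i j a => \sum_b G i j p a b)); apply: eq_bigr => a _.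
exact: (ex (fun i j b => G i j p a b)).
Qed.

End Positivity.

(** * The equation exp (- alpha Phi) = det D^2 Phi *)

(** The bookkeeping of the coefficients, with [t = g_ij] and
    [q = g_ki g^k_j]. *)
Lemma alpha_terms (R : numFieldType) (a t q N S : R) :
  (2^-1 * 2^-1 * q + 2^-1 * a * t) + (2^-1 * 2^-1 * q + 2^-1 * a * t) + 2 * N + 8 * S =
  - a * t - a * t + 2^-1 * (a * t + a * t) + 2 * (a * t) + 2^-1 * q + 2 * N + 8 * S.
Proof. by field. Qed.

Section Alpha_equation.
Variables (R : realType) (n : nat) (Omega : set 'rV[R]_n) (Phi : 'rV[R]_n -> R) (alpha : R).
Local Notation point := 'rV[R]_n.
Hypothesis Omega_open : open Omega.
Hypothesis Phi_C5 : Ck_on 5 Omega Phi.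
Hypothesis Phi_convex : convex_function Omega Phi.
Hypothesis MA : forall x, Omega x -> expR (- (alpha * Phi x)) = \det (hess Phi x).
Local Notation h := (hess Phi).
Local Notation g := (gtensor Phi).
Local Notation V := (fun x => alpha * Phi x).
Local Notation W := (fun _ : point => 0 : R).

Let setT_open : open [set: point]. Proof. exact: openT. Qed.
Let W_C3 : Ck_on 3 [set: point] W. Proof. exact: Ck_on_cst. Qed.
Let grad_T x : Omega x -> [set: point] (grad Phi x). Proof. by []. Qed.
Let V_C3 : Ck_on 3 Omega V.
Proof. exact: (Ck_on_scale alpha Omega_open (Ck_on_le (Ck_on_le Phi_C5))). Qed.
Let MA_VW x : Omega x -> expR (- V x) = expR (- W (grad Phi x)) * \det (h x).
Proof. by move=> Ox; rewrite oppr0 expR0 mul1r MA. Qed.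
Let h_unit x : Omega x -> h x \in unitmx.
Proof. exact: (Monge_Ampere_unit MA_VW). Qed.

Let hsym x i j : Omega x -> h x i j = h x j i.
Proof. exact: (hess_sym Omega_open Phi_C5). Qed.

(** A formal identity: the two contracted pairs of indices join the same factors. *)
Lemma gtensor_sym x i j : Omega x -> g i j x = g j i x.
Proof.
move=> Ox; apply: (ev_identity Omega_open setT_open Phi_C5 W_C3 grad_T i [:: i; j] Ox
  (e1 := gE 0 1) (e2 := gE 1 0)).
by vm_compute.
Qed.

Let gg_sym x i j : Omega x ->
  \sum_k g k i x * mixed h g k j x = \sum_k g k j x * mixed h g k i x.
Proof.
move=> Ox; apply: (ev_identity Omega_open setT_open Phi_C5 W_C3 grad_T i [:: i; j] Ox
  (e1 := Sum (gE 0 1 * mixedE gE 0 2)%expr) (e2 := Sum (gE 0 2 * mixedE gE 0 1)%expr)).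
by vm_compute.
Qed.

(** The derivatives of [V] give [- 2 alpha g + alpha g + 2 alpha g = alpha g], which
    is the contribution of [V_ij / 2] in [Ric_mu] to the two products; the part
    [g / 4] of [Ric_mu] contributes [g_ki g^k_j / 2]. *)
Lemma wlaplacian_gtensor_alpha x i j : Omega x ->
  wlaplacian Phi V W g i j x =
    \sum_k g k i x * mixed h (ric_mu Phi V W) k j x
  + \sum_k g k j x * mixed h (ric_mu Phi V W) k i x
  + 2 * nabla_sq Phi i j x + 8 * riem_sq Phi i j x.
Proof.
move=> Ox.
have V2 a b : D2 V a b x = alpha * h x a b.
  by rewrite mxE; exact: (iter_partial_scale alpha (ix := [:: a; b]) Omega_open Phi_C5).
have V3 a b c : D3 V a b c x = alpha * D3 Phi a b c x.
  exact: (iter_partial_scale alpha (ix := [:: a; b; c]) Omega_open Phi_C5).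
have D2W a b y : D2 W a b y = 0 by rewrite /D2 !partial_cst.
have D3W a b c y : D3 W a b c y = 0 by rewrite /D3 /D2 !partial_cst.
have W2 a b : W2l Phi W a b x = 0.
  by apply: big1 => c _; rewrite /lower big1 ?mulr0 // => d _; rewrite D2W mulr0.
have W3 a b c : W3l Phi W a b c x = 0.
  apply: big1 => d _; rewrite /lower2 /lower big1 ?mulr0 // => e _.
  by rewrite big1 ?mulr0 // => f _; rewrite D3W mulr0.
have Ric a b : ric_mu Phi V W a b x = 2^-1 * 2^-1 * g a b x + 2^-1 * (alpha * h x a b).
  rewrite (ric_mu_gtensor Omega_open setT_open Phi_C5 V_C3 W_C3 grad_T MA_VW i) //.
  by rewrite V2 W2 mulr0 addr0.
have mixRic k l : \sum_m g m k x * mixed h (ric_mu Phi V W) m l x =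
    2^-1 * 2^-1 * (\sum_m g m k x * mixed h g m l x) + 2^-1 * alpha * g k l x.
  have E m : mixed h (ric_mu Phi V W) m l x =
      2^-1 * 2^-1 * mixed h g m l x + 2^-1 * alpha * (m == l)%:R.
    have -> : (m == l)%:R = \sum_a hinv h m a x * h x a l.
      have := mulVmx (h_unit Ox) => /matrixP/(_ m l); rewrite !mxE => <-.
      by [].
    rewrite /mixed /raise !mulr_sumr -big_split; apply: eq_bigr => a _ /=.
    by rewrite Ric; ring.
  under eq_bigr do rewrite E mulrDr.
  rewrite big_split mulr_sumr /=; congr (_ + _).
    by apply: eq_bigr => m _; ring.
  rewrite (bigD1 l) //= eqxx big1 ?addr0 => [|m ml].
    by rewrite mulr1 mulrC gtensor_sym.
  by rewrite (negbTE ml) !mulr0.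
rewrite (wlaplacian_gtensor Omega_open setT_open Phi_C5 V_C3 W_C3 grad_T MA_VW i) //.
have T1 k l : \sum_a \sum_b (- D3 V k a b x + W3l Phi W k a b x) * Phi3_uu Phi l a b x =
    - alpha * g k l x.
  rewrite mulr_sumr; apply: eq_bigr => a _; rewrite mulr_sumr; apply: eq_bigr => b _.
  by rewrite V3 W3; ring.
have T2 k l : \sum_s (D2 V k s x + W2l Phi W k s x) * mixed h g s l x = alpha * g k l x.
  rewrite -(hessK h_unit k (fun s => g s l x) Ox) mulr_sumr; apply: eq_bigr => s _.
  by rewrite V2 W2 addr0 mulrA.
have T3 : \sum_a \sum_m \sum_b (D2 V a m x + W2l Phi W a m x) * Phi3_u Phi m i b x
     * Phi3_uu Phi j a b x = alpha * g i j x.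
  rewrite mulr_sumr; apply: eq_bigr => a _; rewrite exchange_big mulr_sumr.
  apply: eq_bigr => b _ /=; rewrite -mulr_suml mulrA; congr (_ * _).
  transitivity (alpha * \sum_m h x a m * Phi3_u Phi m i b x).
    by rewrite mulr_sumr; apply: eq_bigr => m _; rewrite V2 W2 addr0 mulrA.
  apply: (congr1 ( *%R _)).
  apply: (etrans (hessK h_unit a (fun k => D3 Phi k i b x) Ox)).
  exact: (@iter_partial_swap R n 5 Omega Phi [::] a i [:: b]).
pose Q := \sum_k g k i x * mixed h g k j x.
have gji : g j i x = g i j x by exact: gtensor_sym.
have M1 : \sum_k g k i x * mixed h (ric_mu Phi V W) k j x =
    2^-1 * 2^-1 * Q + 2^-1 * alpha * g i j x by exact: mixRic.
have M2 : \sum_k g k j x * mixed h (ric_mu Phi V W) k i x =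
    2^-1 * 2^-1 * Q + 2^-1 * alpha * g i j x.
  by apply: (etrans (mixRic j i)); rewrite gji -(gg_sym i j Ox).
transitivity (- alpha * g i j x - alpha * g i j x +
  2^-1 * (alpha * g i j x + alpha * g i j x) + 2 * (alpha * g i j x) + 2^-1 * Q +
  2 * nabla_sq Phi i j x + 8 * riem_sq Phi i j x).
  do 3 apply: (congr2 +%R _ erefl).
  apply: (congr2 +%R); last by apply: (congr1 ( *%R _)); exact: T3.
  apply: (congr2 +%R).
    by apply: (congr2 +%R); [exact: T1|rewrite -mulNr -gji; exact: T1].
  apply: (congr1 ( *%R _)); apply: (congr2 +%R); first exact: T2.
  by rewrite -gji; exact: T2.
apply/esym; apply: (etrans (y := (2^-1 * 2^-1 * Q + 2^-1 * alpha * g i j x) +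
  (2^-1 * 2^-1 * Q + 2^-1 * alpha * g i j x) +
  2 * nabla_sq Phi i j x + 8 * riem_sq Phi i j x)).
  by do 2 apply: (congr2 +%R _ erefl); apply: (congr2 +%R); [exact: M1|exact: M2].
exact: alpha_terms.
Qed.

(** The form of the inverse [H] at [u] is the form of the Hessian at [u H]. *)
Lemma hinv_psd x : Omega x -> (invmx (h x))^T = invmx (h x) /\ psd (invmx (h x)).
Proof.
move=> Ox; have hT : (h x)^T = h x by apply/matrixP => i j; rewrite mxE hsym.
have HT : (invmx (h x))^T = invmx (h x) by rewrite trmx_inv hT.
split=> // u; set H := invmx (h x) in HT *.
have -> : u *m H *m u^T = (u *m H) *m h x *m (u *m H)^T.
  by rewrite trmx_mul HT mulmxA mulmxKV ?h_unit.
have := @convex_hess_ge0 R n Omega Phi x (u *m H) Omega_open.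
rewrite mxE; move: (u *m H) => v.
have -> : \sum_j (v *m h x) 0 j * v^T j 0 = \sum_i \sum_j h x i j * v 0 i * v 0 j.
  rewrite exchange_big; apply: eq_bigr => j _; rewrite [v^T _ _]mxE mxE mulr_suml.
  by apply: eq_bigr => i _; rewrite [v 0 i * _]mulrC.
apply=> //.
- by move=> y Oy; exact: (Ck_on_C1 Omega_open Oy Phi_C5).
- by move=> y i Oy; exact: (@iter_partial_C1 R n 5 Omega Phi [:: i]).
move=> i j; have := Ck_on_cont (@Ck_on_iter R n 5 Omega Phi [:: i; j] Phi_C5 isT).
by apply; rewrite inE.
Qed.

Lemma wlaplacian_gtensor_alpha_ge x : Omega x ->
  quad_le (fun i j => 2 * sym_prod h g (ric_mu Phi V W) i j x)
          (fun i j => wlaplacian Phi V W g i j x).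
Proof.
move=> Ox v; have [HT Hpsd] := hinv_psd Ox.
have N0 := @gram_ge0 R n h (fun i p a b => cov3 h (D3 Phi) p i a b) x v HT Hpsd.
have R0 := @gram_ge0 R n h (riemann h) x v HT Hpsd.
rewrite -subr_ge0.
suff -> : \sum_i \sum_j wlaplacian Phi V W g i j x * v i * v j -
    \sum_i \sum_j 2 * sym_prod h g (ric_mu Phi V W) i j x * v i * v j =
    2 * (\sum_i \sum_j nabla_sq Phi i j x * v i * v j) +
    8 * (\sum_i \sum_j riem_sq Phi i j x * v i * v j).
  by rewrite addr_ge0 // mulr_ge0 // ler0n.
rewrite !mulr_sumr -sumrB -big_split; apply: eq_bigr => i _ /=.
rewrite !mulr_sumr -sumrB -big_split; apply: eq_bigr => j _ /=.
rewrite (wlaplacian_gtensor_alpha i j Ox).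
have -> : 2 * sym_prod h g (ric_mu Phi V W) i j x =
    \sum_k g k i x * mixed h (ric_mu Phi V W) k j x
  + \sum_k g k j x * mixed h (ric_mu Phi V W) k i x.
  rewrite mulrA divff ?pnatr_eq0 // mul1r -big_split; apply: eq_bigr => k _ /=.
  by rewrite (gtensor_sym i k Ox) (gtensor_sym j k Ox).
have expand (r N S a b : R) :
    (r + 2 * N + 8 * S) * a * b - r * a * b = 2 * (N * a * b) + 8 * (S * a * b) by ring.
exact: expand.
Qed.

End Alpha_equation.

Theorem proposition3p4 (R : realType) (n : nat)
    (Omega : set 'rV[R]_n) (Phi : 'rV[R]_n -> R)
    (Omega_open : open Omega) (Omega_convex : convex_set Omega)
    (Phi_C5 : Ck_on 5 Omega Phi) (Phi_convex : convex_function Omega Phi) :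
  (forall (U : set 'rV[R]_n) (V W : 'rV[R]_n -> R),
     open U -> grad Phi @` Omega `<=` U ->
     Ck_on 3 Omega V -> Ck_on 3 U W ->
     (forall x, Omega x ->
        expR (- V x) = expR (- W (grad Phi x)) * \det (hess Phi x)) ->
     forall x, Omega x -> forall i j : 'I_n,
       wlaplacian Phi V W (gtensor Phi) i j x =
         \sum_a \sum_b (- D3 V i a b x + W3l Phi W i a b x) * Phi3_uu Phi j a b x
       + \sum_a \sum_b (- D3 V j a b x + W3l Phi W j a b x) * Phi3_uu Phi i a b x
       + 2^-1 * (\sum_s (D2 V i s x + W2l Phi W i s x)
                        * mixed (hess Phi) (gtensor Phi) s j x
               + \sum_s (D2 V j s x + W2l Phi W j s x)
                        * mixed (hess Phi) (gtensor Phi) s i x)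
       + 2 * \sum_a \sum_m \sum_b (D2 V a m x + W2l Phi W a m x)
                                  * Phi3_u Phi m i b x * Phi3_uu Phi j a b x
       + 2^-1 * \sum_k gtensor Phi k i x * mixed (hess Phi) (gtensor Phi) k j x
       + 2 * nabla_sq Phi i j x
       + 8 * riem_sq Phi i j x)
  /\
  (forall (alpha : R) (V := fun x => alpha * Phi x)
          (W := fun _ : 'rV[R]_n => 0 : R),
     (forall x, Omega x -> expR (- (alpha * Phi x)) = \det (hess Phi x)) ->
     forall x, Omega x ->
       (forall i j : 'I_n,
          wlaplacian Phi V W (gtensor Phi) i j x =
            \sum_k gtensor Phi k i x
                   * mixed (hess Phi) (ric_mu Phi V W) k j x
          + \sum_k gtensor Phi k j x
                   * mixed (hess Phi) (ric_mu Phi V W) k i x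
          + 2 * nabla_sq Phi i j x
          + 8 * riem_sq Phi i j x)
       /\
       quad_le (fun i j => 2 * sym_prod (hess Phi) (gtensor Phi)
                                        (ric_mu Phi V W) i j x)
               (fun i j => wlaplacian Phi V W (gtensor Phi) i j x)).
Proof.
split=> [U V W U_open Phi_U V_C3 W_C3 MA x Ox i j|alpha V W MA x Ox].
  have grad_U y : Omega y -> U (grad Phi y) by move=> Oy; apply: Phi_U; exists y.
  exact: (wlaplacian_gtensor Omega_open U_open Phi_C5 V_C3 W_C3 grad_U MA i).
split=> [i j|]; first exact: (wlaplacian_gtensor_alpha Omega_open Phi_C5 MA).
exact: (wlaplacian_gtensor_alpha_ge Omega_open Phi_C5 Phi_convex MA).
Qed.
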